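(* Let $m\ge1$ and $c\ge2$ be integers, let $p_1,\dots,p_m\in\mathbb P^1\setminus\{\infty\}$ be distinct points, and let $\varphi:X_q\to\mathbb P^1$ be the cyclic cover corresponding to the surjection $q:F_m\twoheadrightarrow\mathbb Z/c\mathbb Z$, $x_i\mapsto1$. Let $s_1$ be the integer with $\mathcal F_{X_q}(V_1)_{(0,\dots,0)}\cong\mathcal O(s_1)$. Then $$s_1=-\frac{m+\kappa_{m,c}}{c}.$$
   Context: The ground field $k$ is algebraically closed of characteristic $0$; $e^{2\pi\sqrt{-1}/n}$ denotes a fixed compatible choice of primitive $n$-th roots of unity. $F_m$ is the free group on $x_1,\dots,x_m$. For a point $x$ of ramification index $r$ on a Galois cover, the canonical generator of its (cyclic, order $r$) stabilizer is the element $g$ acting on the fibre of $\mathcal O(-x)$ at $x$ by $g^*s\equiv e^{2\pi\sqrt{-1}/r}s$, $s$ a local parameter. $X_q\to\mathbb P^1$ is the connected Galois $\mathbb Z/c\mathbb Z$-cover, étale outside $\{p_1,\dots,p_m,\infty\}$, for which $1+c\mathbb Z$ is the canonical generator of the stabilizer at the point over each $p_i$ (concretely the normalization of $y^c=\prod_i(z-p_i)$ with the generator acting by $y\mapsto e^{2\pi\sqrt{-1}/c}y$ on functions). $V_j$ ($0\le j\le c-1$) is the one dimensional representation of $\mathbb Z/c\mathbb Z$ on which $1+c\mathbb Z$ acts by $e^{2\pi j\sqrt{-1}/c}$. The value at $(0,\dots,0)$ of the parabolic bundle $\mathcal F_{X_q}(V_j)_\bullet$ is $(\varphi_*(\mathcal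 O_{X_q}\otimes_kV_j))^{\mathbb Z/c\mathbb Z}$, where invariants are $V_j$-valued functions $\psi$ with $\psi(gx)=g\psi(x)$. $w_j$ denotes the rational number in $[0,1)$ which differs from $-\frac{mj}{c}$ by an integer, and $$\kappa_{m,c}=\bigl|\{j:1\le j\le c-1,\ w_1+w_j\ge1\}\bigr| .$$ *)

(* Defs.v *)
From mathcomp Require Import all_boot all_order all_algebra all_fingroup.
From mathcomp Require Import all_solvable all_field.
From mathcomp Require Import boolp classical_sets functions cardinality.

Set Implicit Arguments.
Unset Strict Implicit.
Unset Printing Implicit Defensive.

Import Order.TTheory GRing.Theory Num.Theory.
Local Open Scope ring_scope.
Local Open Scope classical_set_scope.

(* Curves are used through their function fields: a connected smooth
   projective curve X with a finite morphism to P^1 is a finite extension L of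
   k(z), the closed points of X are the valuation rings of L over k, and a
   function is regular at a point when it lies in the valuation ring.  A
   (quasi-coherent, torsion-free) sheaf on P^1 is given by its sections over
   the nonempty open sets, as a subsheaf of a constant sheaf. *)

Definition compatible_roots (k : fieldType) (zeta : nat -> k) : Prop :=
  (forall n, (0 < n)%N -> n.-primitive_root (zeta n)) /\
  (forall n d, (0 < n)%N -> (0 < d)%N -> zeta (n * d)%N ^+ d = zeta n).

(** * The projective line *)

Notation ratfun k := {fraction {poly k}}.

Definition ratfun_of (k : fieldType) (n : {poly k}) : ratfun k := tofrac n.

(* closed points; None is the point at infinity *)
Definition P1 (k : fieldType) := option k.

Definition stalk (k : fieldType) (p : P1 k) : set (ratfun k) :=
  [set f | exists n d : {poly k},
     f = ratfun_of n / ratfun_of d /\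
     if p is Some a then d.[a] != 0 else (d != 0) && (size n <= size d)%N].

Definition uniformizer (k : fieldType) (p : P1 k) : ratfun k :=
  if p is Some a then ratfun_of ('X - a%:P) else (ratfun_of 'X)^-1.

(* The nonempty Zariski open subsets of P^1 (k is infinite). *)
Definition nonempty_open (k : fieldType) (U : set (P1 k)) : Prop :=
  finite_set (~` U).

Definition regular (k : fieldType) (U : set (P1 k)) : set (ratfun k) :=
  [set f | forall p, U p -> stalk p f].

(* O(s), realised as O(s * infinity): rational functions whose only pole is at
   infinity, of order at most s there. *)
Definition O_twist (k : fieldType) (s : int) (U : set (P1 k)) :
    set (ratfun k)^o :=
  [set f : (ratfun k)^o | forall p, U p ->
     stalk p (if p is Some _ then f else f * uniformizer p ^ s)].

(* Isomorphism of sheaves of O-modules; M and N are the (generic stalks)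
   constant sheaves containing F and G. *)
Definition sheaf_iso (k : fieldType) (M N : lmodType (ratfun k))
    (F : set (P1 k) -> set M) (G : set (P1 k) -> set N) : Prop :=
  exists theta : set (P1 k) -> M -> N,
  [/\ forall U, nonempty_open U -> set_bij (F U) (G U) (theta U),
      forall U, nonempty_open U -> forall a f f',
        regular U a -> F U f -> F U f' ->
        theta U (a *: f + f') = a *: theta U f + theta U f'
    & forall U U', nonempty_open U -> nonempty_open U' -> U `<=` U' ->
        forall f, F U' f -> theta U f = theta U' f].

(** * Points of a curve with function field L *)

Definition const (k : fieldType) (L : fieldExtType (ratfun k)) (a : k) : L :=
  (ratfun_of a%:P)%:A.

Definition is_point (k : fieldType) (L : fieldExtType (ratfun k))
    (x : set L) : Prop :=
  [/\ forall a, x (const L a),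
      forall f g, x f -> x g -> x (f - g) /\ x (f * g),
      forall f, x f \/ x f^-1
    & x <> setT].

Definition lies_over (k : fieldType) (L : fieldExtType (ratfun k))
    (x : set L) (p : P1 k) : Prop :=
  forall f : ratfun k, x f%:A <-> stalk p f.

Definition unit_at (k : fieldType) (L : fieldExtType (ratfun k))
    (x : set L) (f : L) : Prop := [/\ f != 0, x f & x f^-1].

Definition local_parameter (k : fieldType) (L : fieldExtType (ratfun k))
    (x : set L) (s : L) : Prop :=
  forall f, (x f /\ ~ unit_at x f) <-> (exists2 u, x u & f = s * u).

Definition ramification_index (k : fieldType) (L : fieldExtType (ratfun k))
    (x : set L) (p : P1 k) (s : L) (r : nat) : Prop :=
  unit_at x ((uniformizer p)%:A / s ^+ r).

(** * Cyclic covers *)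

(* rho h is the pullback h^* of functions along the automorphism h. *)
Definition stabilizes (k : fieldType) (L : splittingFieldType (ratfun k))
    (c : nat) (rho : {morphism [set: 'Z_c] >-> gal_of {:L}})
    (x : set L) (h : 'Z_c) : Prop :=
  forall f, x (rho h f) <-> x f.

Definition canonical_generator (k : fieldType) (zeta : nat -> k)
    (L : splittingFieldType (ratfun k)) (c : nat)
    (rho : {morphism [set: 'Z_c] >-> gal_of {:L}})
    (x : set L) (p : P1 k) (h : 'Z_c) : Prop :=
  (forall h' : 'Z_c, stabilizes rho x h' <-> h' \in <[h]>%g) /\
  exists (s : L) (r : nat),
    [/\ local_parameter x s,
        ramification_index x p s r
      & exists2 u, x u & rho h s - const L (zeta r) * s = s ^+ 2 * u].

(* The connected Galois Z/c-cover of P^1, etale outside p_1, ..., p_m and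
   infinity, corresponding to the homomorphism F_m -> Z/c, x_i |-> q i. As k
   has characteristic 0 and is the residue field of every point, etale means
   that the ramification index is 1. *)
Definition is_cyclic_cover (k : fieldType) (zeta : nat -> k)
    (m c : nat) (p : 'I_m -> k) (q : 'I_m -> 'Z_c)
    (L : splittingFieldType (ratfun k))
    (rho : {morphism [set: 'Z_c] >-> gal_of {:L}}) : Prop :=
  [/\ galois 1 {:L},
      isom [set: 'Z_c]%G 'Gal({:L} / 1) rho,
      forall (a : k) (x : set L), (forall i, a <> p i) ->
        is_point x -> lies_over x (Some a) ->
        exists2 s, local_parameter x s & ramification_index x (Some a) s 1
    & forall (i : 'I_m) (x : set L), is_point x -> lies_over x (Some (p i)) ->
        canonical_generator zeta rho x (Some (p i)) (q i)].

(** * The bundle F_X(V_j) at parabolic weight (0, ..., 0) *)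

(* the character of the one-dimensional representation V_j *)
Definition V (k : fieldType) (zeta : nat -> k) (c j : nat) (h : 'Z_c) : k :=
  zeta c ^+ (j * h).
Arguments V {k} zeta c j h.

Definition pushforward (k : fieldType) (L : fieldExtType (ratfun k))
    (U : set (P1 k)) : set L :=
  [set psi | forall p x, U p -> is_point x -> lies_over x p -> x psi].

(* (phi_* (O_X (x) W))^(Z/c) for a character W of Z/c *)
Definition F_X0 (k : fieldType) (L : splittingFieldType (ratfun k)) (c : nat)
    (rho : {morphism [set: 'Z_c] >-> gal_of {:L}}) (W : 'Z_c -> k)
    (U : set (P1 k)) : set L :=
  [set psi | pushforward U psi /\
             forall h : 'Z_c, rho h psi = const L (W h) * psi].

(** * The numbers w_j and kappa *)

Definition w (m c j : nat) : rat :=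
  let t : rat := - ((m * j)%:R / c%:R) in t - (Num.floor t)%:~R.

Definition kappa (m c : nat) : nat :=
  #|[set j : 'I_c | (1 <= j)%N && (1 <= w m c 1 + w m c j)]%SET|.

(* Main.v *)
Require Import Defs.
From mathcomp Require Import all_boot all_order all_algebra all_fingroup.
From mathcomp Require Import all_solvable all_field.
From mathcomp Require Import boolp classical_sets functions cardinality.
From HB Require Import structures.
From mathcomp Require Import ring lra zify.
Import Order.TTheory GRing.Theory Num.Theory.
Local Open Scope ring_scope.

(** The function field L is a Kummer extension of K = k(z): Hilbert's theorem 90
    gives a nonzero y in L with g^* y = e^(2 pi i / c) y for the generator g, and
    then y^c = N lies in K.  Multiplying y by an element of K, N can be taken to
    be a polynomial of least degree; then no N is divisible by (z - a)^c.

    The multiplicities of the roots of N are read off from the geometry.  At a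
    point x of the curve over a, with local parameter s and ramification index
    r, write v for the order at a and n for the order of y in s.  Comparing the
    orders of y^c and N gives c n = r v(N) (ramified_order).  If r = 1 then c
    divides v(N), so N(a) <> 0.  If a = p_i, the canonical generator multiplies
    s by zeta_r modulo s^2 and y by zeta_c exactly; as the residue field of x is
    k (point_residue), these agree modulo the maximal ideal only if
    zeta_c = zeta_r^n, and compatibility of the roots of unity turns this into
    v(N) = 1 modulo c (canonical_order).  Hence N is a constant multiple of the
    product of the z - p_i (kummer_normal_form).

    A section of the bundle is y g with g in K, and it is regular at the points
    over p exactly when N g^c is regular at p, because valuation rings are
    integrally closed.  At a finite point this says that g is regular, as the
    order of N there is 0 or 1 and c > 1; at infinity, where N has order -m, it
    says that g vanishes to order at least m / c.  So the bundle is
    y O(floor(- m / c)) (F_X0P).  That O(s) determines s is seen on the charts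
    around 0 and infinity (iso_O_twist_le).  Finally
    floor(- m / c) = - m / c - w_1, and c w_1 = kappa because
    w_(j+1) - w_j = w_1 - [w_1 + w_j >= 1] telescopes to 0 over a period
    (kappaE).

    All local arguments need actual points of the curve over each point of P^1.
    They are provided by Chevalley's extension theorem for valuation rings
    (chevalley_extension, exists_point). *)

(** * Extension of valuation rings *)

(** Points of a curve are given as sets of functions, so subrings are treated as
    sets too, without a ring structure of their own. *)
Definition subring_set {E : fieldType} (A : set E) : Prop :=
  A 1 /\ forall f g, A f -> A g -> A (f - g) /\ A (f * g).

Definition valuation_set {E : fieldType} (A : set E) : Prop :=
  subring_set A /\ forall f, A f \/ A f^-1.

Lemma subring_set0 {E : fieldType} (A : set E) : subring_set A -> A 0.
Proof. by case=> A1 AA; case: (AA 1 1) => //; rewrite subrr. Qed.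

Lemma subring_setB {E : fieldType} (A : set E) f g :
  subring_set A -> A f -> A g -> A (f - g).
Proof. by case=> A1 AA Af Ag; case: (AA f g). Qed.

Lemma subring_setM {E : fieldType} (A : set E) f g :
  subring_set A -> A f -> A g -> A (f * g).
Proof. by case=> A1 AA Af Ag; case: (AA f g). Qed.

Lemma subring_setN {E : fieldType} (A : set E) f :
  subring_set A -> A f -> A (- f).
Proof.
move=> hA Af; rewrite -sub0r; apply: subring_setB => //.
exact: subring_set0.
Qed.

Lemma subring_setD {E : fieldType} (A : set E) f g :
  subring_set A -> A f -> A g -> A (f + g).
Proof.
move=> hA Af Ag; rewrite -[g]opprK; apply: subring_setB => //.
exact: subring_setN.
Qed.

Lemma subring_setX {E : fieldType} (A : set E) f n :
  subring_set A -> A f -> A (f ^+ n).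
Proof.
move=> hA Af; elim: n => [|n IH]; first by case: hA.
by rewrite exprS; apply: subring_setM.
Qed.

Lemma subring_set_sum {E : fieldType} (A : set E) (I : Type) (r : seq I)
    (P : pred I) (F : I -> E) :
  subring_set A -> (forall i, P i -> A (F i)) -> A (\sum_(i <- r | P i) F i).
Proof.
move=> hA AF; elim/big_rec: _ => [|i y Pi Ay]; first exact: subring_set0.
by apply: subring_setD => //; apply: AF.
Qed.

Lemma subring_set_coefM {E : fieldType} (A : set E) (P Q : {poly E}) :
  subring_set A -> (forall i, A P`_i) -> (forall i, A Q`_i) ->
  forall i, A (P * Q)`_i.
Proof.
move=> hA AP AQ i; rewrite coefM; apply: subring_set_sum => // j _.
exact: subring_setM.
Qed.

Definition adjoin {E : fieldType} (A : set E) (u : E) : set E :=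
  [set f | exists2 P : {poly E}, forall i, A P`_i & f = P.[u]]%classic.

Lemma adjoin_subring {E : fieldType} (A : set E) u :
  subring_set A -> subring_set (adjoin A u).
Proof.
move=> hA; have A0 := subring_set0 A hA; split.
  exists 1; last by rewrite hornerC.
  by move=> i; rewrite coef1; case: eqP => // _; case: hA.
move=> _ _ [P AP ->] [Q AQ ->]; split.
  exists (P - Q); last by rewrite hornerD hornerN.
  by move=> i; rewrite coefB; apply: subring_setB.
by exists (P * Q); rewrite ?hornerM //; apply: subring_set_coefM.
Qed.

Lemma sub_adjoin {E : fieldType} (A : set E) u :
  subring_set A -> (A `<=` adjoin A u)%classic.
Proof.
move=> hA f Af; exists f%:P; last by rewrite hornerC.
by move=> i; rewrite coefC; case: eqP => // _; apply: subring_set0.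
Qed.

Lemma mem_adjoin {E : fieldType} (A : set E) u :
  subring_set A -> adjoin A u u.
Proof.
move=> hA; exists 'X; last by rewrite hornerX.
move=> i; rewrite coefX; case: eqP => // _; last exact: subring_set0.
by case: hA.
Qed.

(** With f = t^-1, this is a subring maximal among those in which t is not
    invertible. *)
Definition maximal_without {E : fieldType} (f : E) (A : set E) : Prop :=
  [/\ subring_set A, ~ A f
    & forall B, subring_set B -> (A `<=` B)%classic -> ~ B f -> (B `<=` A)%classic].

(** Zorn's lemma: a union of a chain of subrings avoiding f is one. *)
Lemma exists_maximal_without {E : fieldType} (A : set E) (f : E) :
  subring_set A -> ~ A f -> exists2 B, (A `<=` B)%classic & maximal_without f B.
Proof.
move=> hA nAf.
(* The empty set is admitted because it is the union of the empty chain. *)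
pose P (B : set E) := (B `<=` set0)%classic \/
  [/\ subring_set B, (A `<=` B)%classic & ~ B f].
have [F FP Ftot|B [PB maxB]] := @Zorn_bigcup E P.
  have [B0|] := pselect ((\bigcup_(X in F) X)%classic `<=` set0)%classic.
    by left.
  move=> nB0; right.
  have [e [X0 FX0 X0e]] : exists e, (\bigcup_(X in F) X)%classic e.
    by apply: contrapT => h; apply: nB0 => e he; case: h; exists e.
  have good X : F X -> (exists e, X e) ->
      [/\ subring_set X, (A `<=` X)%classic & ~ X f].
    by move=> FX [e' Xe']; case: (FP X FX) => // /(_ e' Xe').
  have [hX0 AX0 _] := good X0 FX0 (ex_intro _ e X0e).
  split.
  - split; first by exists X0 => //; case: hX0.
    move=> a b [X FX Xa] [Y FY Yb].
    have [hX AX _] := good X FX (ex_intro _ a Xa).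
    have [hY AY _] := good Y FY (ex_intro _ b Yb).
    have [XY|YX] := Ftot X Y FX FY.
      by split; exists Y => //; [apply: subring_setB|apply: subring_setM] => //;
         apply: XY.
    by split; exists X => //; [apply: subring_setB|apply: subring_setM] => //;
       apply: YX.
  - by move=> a Aa; exists X0 => //; apply: AX0.
  - by move=> [X FX Xf]; case: (good X FX (ex_intro _ f Xf)).
have PA : P A by rewrite /P; right; split.
case: PB => [B0|[hB AB nBf]].
  exfalso; apply: (maxB A) => //; split.
    by move=> a /B0.
  by move=> AB; apply: (B0 1); apply: AB; case: hA.
exists B => //; split=> // C hC BC nCf c Cc; apply: contrapT => nBc.
apply: (maxB C); first by split=> // CB; apply: nBc; apply: CB.
by rewrite /P; right; split=> //; apply: (subset_trans AB).
Qed.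

(** Clearing denominators in A[1/v]. *)
Lemma horner_inv_clear {E : fieldType} (A : set E) (P : {poly E}) v :
  subring_set A -> (forall i, A P`_i) -> A v -> v != 0 ->
  A (v ^+ size P * P.[v^-1]).
Proof.
move=> hA AP Av v0; rewrite horner_coef mulr_sumr.
apply: subring_set_sum => // i _.
rewrite mulrCA exprVn -expfB_cond; last first.
  by rewrite (negbTE v0) add0n ltnW.
by apply: subring_setM => //; apply: subring_setX.
Qed.

(** t lies in the Jacobson radical: adjoining the inverse of 1 - t b cannot make
    t invertible, since a power of 1 - t b is still of the form 1 - t a and
    t^-1 = a' / (1 - t a) would give t^-1 = a' + a.  So maximality applies. *)
Lemma maximal_without_jacobson {E : fieldType} (A : set E) (t b : E) :
  t != 0 -> A t -> maximal_without t^-1 A -> A b ->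
  1 - t * b != 0 /\ A (1 - t * b)^-1.
Proof.
move=> t0 At [hA nAt maxA] Ab; set v := 1 - t * b.
have Av : A v.
  by apply: subring_setB; [|case: hA|apply: subring_setM].
have v0 : v != 0.
  apply/eqP => /eqP; rewrite subr_eq0 => /eqP tb; apply: nAt.
  by rewrite -[t^-1]mulr1 tb mulKf.
split=> //.
apply: (maxA (adjoin A v^-1)); first exact: adjoin_subring.
- exact: sub_adjoin.
- move=> [P AP tP]; apply: nAt.
  have [a Aa va] : exists2 a, A a & v ^+ size P = 1 - t * a.
    elim: (size P) => [|n [a Aa IH]].
      by exists 0; [apply: subring_set0|rewrite expr0 mulr0 subr0].
    exists (b + a - t * b * a); last by rewrite exprS IH /v; ring.
    by apply: subring_setB => //; [apply: subring_setD|do 2 apply: subring_setM => //].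
  have := horner_inv_clear A P v hA AP Av v0; rewrite -tP va mulrBl mul1r.
  rewrite mulrAC divff // mul1r => h.
  by rewrite -[t^-1](subrK a); apply: subring_setD.
- exact: mem_adjoin.
Qed.

(** Chevalley's descent: if t became invertible both in A[u] and in A[u^-1], take
    such relations of degrees n >= m.  The constant term of the second one can be
    solved for, as 1 - t b is a unit, so that u^n is a combination of lower
    powers of u; substituting it into the first relation lowers n. *)
Lemma maximal_without_descent {E : fieldType} (A : set E) (t : E) :
  t != 0 -> A t -> maximal_without t^-1 A ->
  forall N (u : E) (P Q : {poly E}), (size P + size Q <= N)%N -> u != 0 ->
    (forall i, A P`_i) -> (forall i, A Q`_i) ->
    t * P.[u] = 1 -> t * Q.[u^-1] = 1 -> False.
Proof.
move=> t0 At hmax; have [hA nAt _] := hmax.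
elim=> [|N IH] u P Q sPQ u0 AP AQ tP tQ.
  move: sPQ; rewrite leqn0 addn_eq0 size_poly_eq0 => /andP[/eqP P0 _].
  by move/eqP: tP; rewrite P0 horner0 mulr0 eq_sym oner_eq0.
wlog sQP : u P Q sPQ u0 AP AQ tP tQ / (size Q <= size P)%N.
  move=> hw; case: (leqP (size Q) (size P)) => [h|/ltnW h].
    by apply: (hw u P Q).
  by apply: (hw u^-1 Q P); rewrite ?invrK ?invr_eq0 // addnC.
have nzP : P != 0.
  by apply/eqP => P0; move/eqP: tP; rewrite P0 horner0 mulr0 eq_sym oner_eq0.
set n := (size P).-1.
have sP : size P = n.+1 by rewrite /n prednK // size_poly_gt0.
have [v0 Av] := maximal_without_jacobson A t Q`_0 t0 At hmax (AQ 0).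
set v := 1 - t * Q`_0 in v0 Av.
(* R(u) = u^n (Q(u^-1) - Q(0)); it is a polynomial because deg Q <= n. *)
pose R := \poly_(j < n) Q`_(n - j).
have RE : R.[u] = u ^+ n * (Q.[u^-1] - Q`_0).
  rewrite horner_poly (@horner_coef_wide _ n.+1); last by rewrite -sP.
  rewrite big_ord_recl expr0 mulr1 addrC addKr mulr_sumr.
  rewrite (reindex_inj rev_ord_inj) /=; apply: eq_bigr => i _.
  rewrite subKn // mulrCA /bump /= add1n; congr (_ * _).
  by rewrite exprVn expfB_cond // (negbTE u0) add0n.
have un : u ^+ n = v^-1 * t * R.[u].
  rewrite RE; apply: (mulfI v0); rewrite -!mulrA mulVKf //.
  by rewrite mulrCA mulrBr tQ /v mulrC.
pose P' := \poly_(i < n) P`_i.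
have PE : P.[u] = P'.[u] + P`_n * u ^+ n.
  by rewrite horner_poly [LHS]horner_coef sP big_ord_recr.
have sP2 : (size (P' + (P`_n * v^-1 * t) *: R)%R <= n)%N.
  rewrite (leq_trans (size_polyD _ _)) // geq_max size_poly.
  by rewrite (leq_trans (size_scale_leq _ _)) // size_poly.
apply: (IH u (P' + (P`_n * v^-1 * t) *: R) Q) => //.
- by move: sPQ; rewrite sP addSn ltnS; apply: leq_trans; rewrite leq_add2r.
- have A0 := subring_set0 A hA.
  move=> i; rewrite coefD coefZ; apply: subring_setD => //.
    by rewrite coef_poly; case: ifP.
  apply: subring_setM => //; last by rewrite coef_poly; case: ifP.
  by do 2 apply: subring_setM => //.
- by rewrite hornerD hornerZ -tP PE un !mulrA.
Qed.

Lemma maximal_without_valuation {E : fieldType} (A : set E) (t : E) :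
  t != 0 -> A t -> maximal_without t^-1 A -> valuation_set A.
Proof.
move=> t0 At hmax; have [hA nAt maxA] := hmax; split=> // u.
have [->|u0] := eqVneq u 0; first by left; apply: subring_set0.
have adj x : ~ A x -> adjoin A x t^-1.
  move=> nAx; apply: contrapT => h; apply: nAx.
  apply: (maxA (adjoin A x)) => //; [exact: adjoin_subring|exact: sub_adjoin|].
  exact: mem_adjoin.
apply: contrapT => /not_orP[/adj [P AP tP] /adj [Q AQ tQ]].
apply: (maximal_without_descent A t t0 At hmax _ u P Q (leqnn _)) => //.
  by rewrite -tP divff.
by rewrite -tQ divff.
Qed.

(** A subring in which t is not invertible, maximal for this property, is a
    valuation ring: if it contained neither u nor u^-1, maximality would make t
    invertible after adjoining either of them, against the descent above.  Since
    the ideal that stays proper is principal, this is the form that extends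
    discrete valuation rings. *)
Theorem chevalley_extension {E : fieldType} (A : set E) (t : E) :
  t != 0 -> subring_set A -> A t -> ~ A t^-1 ->
  exists B, [/\ valuation_set B, (A `<=` B)%classic & ~ B t^-1].
Proof.
move=> t0 hA At nAt; have [B AB hB] := exists_maximal_without A t^-1 hA nAt.
exists B; split=> //; last by case: hB.
by apply: (maximal_without_valuation B t t0 _ hB); apply: AB.
Qed.

(** * Orders in a valuation ring *)

(** For a subring A whose maximal ideal is generated by t, the order of f is e
    when unit_in A (f / t ^ e); orders are handled in this form throughout.  At a
    point of a curve, this predicate is unit_at, stated for any field so that it
    serves the local rings of the base as well. *)
Definition unit_in {E : fieldType} (A : set E) (f : E) : Prop :=
  [/\ f != 0, A f & A f^-1].

Lemma unit_in1 {E : fieldType} (A : set E) : subring_set A -> unit_in A 1.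
Proof. by case=> A1 _; split; rewrite ?invr1 ?oner_eq0. Qed.

Lemma unit_inM {E : fieldType} (A : set E) f g :
  subring_set A -> unit_in A f -> unit_in A g -> unit_in A (f * g).
Proof.
move=> hA [f0 Af Af'] [g0 Ag Ag']; split; first by rewrite mulf_neq0.
  exact: subring_setM.
by rewrite invfM; apply: subring_setM.
Qed.

Lemma unit_inV {E : fieldType} (A : set E) f : unit_in A f -> unit_in A f^-1.
Proof. by case=> f0 Af Af'; split; rewrite ?invr_eq0 ?invrK. Qed.

Lemma unit_inX {E : fieldType} (A : set E) f n :
  subring_set A -> unit_in A f -> unit_in A (f ^+ n).
Proof.
move=> hA uf; elim: n => [|n IH]; first exact: unit_in1.
by rewrite exprS; apply: unit_inM.
Qed.

Lemma unit_in_mem {E : fieldType} (A : set E) f g :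
  subring_set A -> unit_in A g -> A (f * g) <-> A f.
Proof.
move=> hA [g0 Ag Ag']; split=> [h|h]; last exact: subring_setM.
by rewrite -[f](mulfK g0); apply: subring_setM.
Qed.

Lemma integrally_closed {E : fieldType} (A : set E) f n :
  valuation_set A -> (0 < n)%N -> A (f ^+ n) -> A f.
Proof.
move=> [hA tA] n0 Afn; case: (tA f) => // Af'.
have [->|f0] := eqVneq f 0; first exact: subring_set0.
case: n n0 Afn => // n _ Afn.
have -> : f = f ^+ n.+1 * f^-1 ^+ n.
  by rewrite exprVn exprS mulfK // expf_neq0.
by apply: subring_setM => //; apply: subring_setX.
Qed.

Lemma order_mem {E : fieldType} (A : set E) (t f : E) (e : int) :
  subring_set A -> A t -> ~ A t^-1 -> t != 0 -> unit_in A (f / t ^ e) ->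
  A f <-> 0 <= e.
Proof.
move=> hA At nAt t0 uf.
have te0 : t ^ e != 0 by rewrite expfz_neq0.
have -> : f = t ^ e * (f / t ^ e) by rewrite mulrC divfK.
rewrite unit_in_mem //; case: e {te0 uf} => n; split=> //.
  by move=> _; apply: subring_setX.
rewrite NegzE -exprnN exprS invfM => h; exfalso; apply: nAt.
have -> : t^-1 = t^-1 * (t ^+ n)^-1 * t ^+ n by rewrite mulfVK // expf_neq0.
by apply: subring_setM => //; apply: subring_setX.
Qed.

Lemma order_neg_inv {E : fieldType} (A : set E) (t f : E) (n : nat) :
  subring_set A -> A t -> t != 0 -> unit_in A (f / t ^ Negz n) ->
  exists2 a, A a & t^-1 = a * f.
Proof.
move=> hA At t0; set u := f / _ => -[u0 _ Au'].
exists (t ^+ n * u^-1).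
  by apply: subring_setM => //; apply: subring_setX.
have -> : f = u * (t * t ^+ n)^-1.
  by rewrite /u NegzE -exprnN invrK exprS mulfK // mulf_neq0 // expf_neq0.
by rewrite mulrA mulfVK // invfM mulrCA divff ?mulr1 // expf_neq0.
Qed.

Lemma order_div {E : fieldType} (A : set E) (t f g : E) (e e' : int) :
  subring_set A -> t != 0 -> unit_in A (f / t ^ e) -> unit_in A (g / t ^ e') ->
  unit_in A (f / g / t ^ (e - e')).
Proof.
move=> hA t0 uf ug.
have -> : f / g / t ^ (e - e') = f / t ^ e * (g / t ^ e')^-1.
  by rewrite expfzDr // -invr_expz !invfM !invrK mulrACA -!mulrA.
by apply: unit_inM => //; apply: unit_inV.
Qed.

Lemma unit_inXz {E : fieldType} (A : set E) f (n : int) :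
  subring_set A -> unit_in A f -> unit_in A (f ^ n).
Proof.
move=> hA uf; case: n => n; first exact: unit_inX.
by rewrite NegzE -exprnN; apply/unit_inV/unit_inX.
Qed.

Lemma order_mul_pow {E : fieldType} (A : set E) (t f g : E) (v e : int) (c : nat) :
  subring_set A -> t != 0 -> unit_in A (f / t ^ v) -> unit_in A (g / t ^ e) ->
  unit_in A (f * g ^+ c / t ^ (v + e * c%:Z)).
Proof.
move=> hA t0 uf ug.
have -> : f * g ^+ c / t ^ (v + e * c%:Z) = f / t ^ v * (g / t ^ e) ^+ c.
  by rewrite expfzDr // -exprz_exp -exprnP invfM expr_div_n mulrACA.
by apply: unit_inM => //; apply: unit_inX.
Qed.

Lemma order_shift {E : fieldType} (A : set E) (t f : E) (e s : int) :
  t != 0 -> unit_in A (f / t ^ e) -> unit_in A (f * t ^ s / t ^ (e + s)).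
Proof.
move=> t0; rewrite expfzDr // invfM mulrACA divff ?expfz_neq0 //.
by rewrite mulr1.
Qed.

Lemma expfz_shift_cancel {E : fieldType} (t h : E) (e e' : int) :
  t != 0 -> t ^ e * h * t ^ e' / t ^ (e + e') = h.
Proof.
move=> t0; rewrite expfzDr // [_ * h * _]mulrAC mulrC mulKf //.
by rewrite mulf_neq0 // expfz_neq0.
Qed.

(** A valuation ring with principal maximal ideal need not be discrete, so y need
    not have an order; but it has one as soon as y^c does.  Dividing y by a power
    of s brings the order of y^c into the range from 0 to c - 1.  If that y were
    not a unit it would be divisible by s, and y^c by s^c. *)
Lemma order_root {E : fieldType} (A : set E) (s y u : E) (c : nat) (a : int) :
  valuation_set A -> s != 0 ->
  (forall f, (A f /\ ~ unit_in A f) <-> (exists2 v, A v & f = s * v)) ->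
  (0 < c)%N -> unit_in A u -> y ^+ c = s ^ a * u ->
  exists2 n : int, unit_in A (y / s ^ n) & a = n * c%:Z.
Proof.
move=> vA s0 ps c0 uu ya; have [hA _] := vA.
have cz0 : c%:Z != 0 by rewrite -lt0n in c0 *.
have [b bc ab] : exists2 b : nat, (b < c)%N & a = (a %/ c%:Z)%Z * c%:Z + b%:Z.
  have := ltz_pmod a (c0 : 0 < c%:Z); have := modz_ge0 a cz0.
  move: (divz_eq a c%:Z); case: (a %% c%:Z)%Z => // b ab _ bc.
  by exists b.
set q := (a %/ c%:Z)%Z in ab; set v := y / s ^ q.
have As : A s by case: ((ps s).2 _) => //; exists 1; rewrite ?mulr1 //; case: hA.
have nus g : A g -> ~ unit_in A (s * g).
  by move=> Ag; case: ((ps (s * g)).2 _) => //; exists g.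
have vc : v ^+ c = s ^+ b * u.
  have sqc : (s ^ q) ^+ c != 0 by rewrite expf_neq0 // expfz_neq0.
  rewrite /v expr_div_n ya {1}ab expfzDr // -exprz_exp -!exprnP.
  by rewrite mulrAC [X in X / _]mulrC mulfK.
have uv : unit_in A v.
  have Av : A v.
    apply: (integrally_closed A v c) => //; rewrite vc; case: uu => _ Au _.
    by apply: subring_setM => //; apply: subring_setX.
  apply: contrapT => nuv.
  have [v' Av' vE] := (ps v).1 (conj Av nuv).
  apply: (nus (s ^+ (c - b).-1 * v' ^+ c)).
    by apply: subring_setM => //; apply: subring_setX.
  suff -> : s * (s ^+ (c - b).-1 * v' ^+ c) = u by [].
  have sb0 : s ^+ b != 0 by rewrite expf_neq0.
  apply: (mulfI sb0); rewrite -vc vE exprMn !mulrA -exprSr -exprD; congr (_ ^+ _ * _).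
  by rewrite addSn -addnS prednK ?subn_gt0 // subnKC // ltnW.
exists q => //.
case: b ab vc bc => [|b] ab vc bc; first by rewrite [LHS]ab addr0.
case: (nus (s ^+ b * u)).
  by apply: subring_setM => //; [apply: subring_setX|case: uu].
by rewrite mulrA -exprS -vc; apply: unit_inX.
Qed.

(** * The local rings of the projective line *)

Lemma subf_div {F : fieldType} (x1 y1 x2 y2 : F) :
  y1 != 0 -> y2 != 0 ->
  x1 / y1 - x2 / y2 = (x1 * y2 - x2 * y1) / (y1 * y2).
Proof. by move=> h1 h2; rewrite -mulNr addf_div // mulNr. Qed.

Lemma ratfun_of0 {k : fieldType} : ratfun_of (0 : {poly k}) = 0.
Proof. exact: tofrac0. Qed.

Lemma ratfun_ofD {k : fieldType} (P Q : {poly k}) :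
  ratfun_of (P + Q) = ratfun_of P + ratfun_of Q.
Proof. exact: tofracD. Qed.

Lemma ratfun_ofB {k : fieldType} (P Q : {poly k}) :
  ratfun_of (P - Q) = ratfun_of P - ratfun_of Q.
Proof. exact: tofracB. Qed.

Lemma ratfun_ofM {k : fieldType} (P Q : {poly k}) :
  ratfun_of (P * Q) = ratfun_of P * ratfun_of Q.
Proof. exact: tofracM. Qed.

Lemma ratfun_ofX {k : fieldType} (P : {poly k}) n :
  ratfun_of (P ^+ n) = ratfun_of P ^+ n.
Proof. exact: tofracXn. Qed.

Lemma ratfun_of1 {k : fieldType} : ratfun_of (1 : {poly k}) = 1.
Proof. exact: tofrac1. Qed.

Lemma ratfunP {k : fieldType} (f : ratfun k) :
  exists n d : {poly k}, d != 0 /\ f = ratfun_of n / ratfun_of d.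
Proof.
elim/quotW: f => x; exists (\n_x), (\d_x); split; first exact: denom_ratioP.
rewrite /ratfun_of; unlock FracField.tofrac.
rewrite -[X in _ = _ * X]FracField.pi_inv -[RHS]FracField.pi_mul.
rewrite /FracField.mulf /FracField.invf.
rewrite !(numden_Ratio, oner_neq0, mul1r, mulr1, denom_ratioP) //.
by rewrite Ratio_numden.
Qed.

Lemma ratfun_of_eq0 {k : fieldType} (P : {poly k}) :
  (ratfun_of P == 0) = (P == 0).
Proof. exact: tofrac_eq0. Qed.

Lemma stalk_subring {k : fieldType} (p : P1 k) : subring_set (stalk p).
Proof.
pose D (n d : {poly k}) : Prop :=
  if p is Some a then d.[a] != 0 else (d != 0) && (size n <= size d)%N.
have D0 n d : D n d -> d != 0.
  rewrite /D; case: (p) => [a|/andP[]//].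
  by apply: contraNneq => ->; rewrite horner0.
have DB n d n' d' : D n d -> D n' d' -> D (n * d' - n' * d) (d * d').
  rewrite /D; case: (p) => [a|]; first by rewrite hornerM => *; rewrite mulf_neq0.
  move=> /andP[d0 nd] /andP[d'0 nd']; rewrite mulf_neq0 //= (size_mul d0 d'0).
  rewrite (leq_trans (size_polyD _ _)) // size_polyN geq_max.
  apply/andP; split; apply: leq_trans (size_polyMleq _ _) _.
    by rewrite -!subn1 leq_sub2r ?leq_add2r.
  by rewrite addnC -!subn1 leq_sub2r ?leq_add2l.
have DM n d n' d' : D n d -> D n' d' -> D (n * n') (d * d').
  rewrite /D; case: (p) => [a|]; first by rewrite hornerM => *; rewrite mulf_neq0.
  move=> /andP[d0 nd] /andP[d'0 nd']; rewrite mulf_neq0 //= (size_mul d0 d'0).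
  rewrite (leq_trans (size_polyMleq _ _)) //.
  by rewrite -!subn1 leq_sub2r ?leq_add.
split.
  exists 1, 1; rewrite ratfun_of1 divr1; split=> //.
  by case: (p) => [a|]; rewrite ?hornerC ?oner_eq0 ?leqnn.
move=> _ _ [n [d [-> Dnd]]] [n' [d' [-> Dnd']]].
have d0 : ratfun_of d != 0 by rewrite ratfun_of_eq0 (D0 n d Dnd).
have d0' : ratfun_of d' != 0 by rewrite ratfun_of_eq0 (D0 n' d' Dnd').
split.
  exists (n * d' - n' * d), (d * d'); split; last exact: DB.
  rewrite ratfun_ofB !ratfun_ofM; exact: (subf_div _ _ _ _ d0 d0').
exists (n * n'), (d * d'); split; last exact: DM.
by rewrite !ratfun_ofM mulf_div.
Qed.

Lemma stalk_const {k : fieldType} (p : P1 k) (a : k) :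
  stalk p (ratfun_of a%:P).
Proof.
exists a%:P, 1; rewrite ratfun_of1 divr1; split=> //.
case: p => [b|]; first by rewrite hornerC oner_eq0.
by rewrite oner_eq0 size_poly1 size_polyC leq_b1.
Qed.

Lemma uniformizer_neq0 {k : fieldType} (p : P1 k) : uniformizer p != 0.
Proof.
by case: p => [a|]; rewrite /= ?invr_eq0 ratfun_of_eq0 ?polyX_eq0 ?polyXsubC_eq0.
Qed.

Lemma stalk_uniformizer {k : fieldType} (p : P1 k) : stalk p (uniformizer p).
Proof.
case: p => [a|].
  exists ('X - a%:P), 1; rewrite ratfun_of1 divr1; split=> //.
  by rewrite hornerC oner_eq0.
exists 1, 'X; rewrite ratfun_of1 div1r; split=> //.
by rewrite polyX_eq0 size_poly1 size_polyX.
Qed.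

Lemma ratfun_div_eq {k : fieldType} (n d n' d' : {poly k}) :
  d != 0 -> d' != 0 -> ratfun_of n / ratfun_of d = ratfun_of n' / ratfun_of d' ->
  n * d' = n' * d.
Proof.
move=> d0 d'0 /eqP; rewrite eqr_div ?ratfun_of_eq0 //.
by rewrite -!ratfun_ofM tofrac_eq => /eqP.
Qed.

Lemma stalk_uniformizerV {k : fieldType} (p : P1 k) : ~ stalk p (uniformizer p)^-1.
Proof.
have r1 := @ratfun_of1 k.
case: p => [a|] [n [d [E H]]].
  have d0 : d != 0 by apply: contraNneq H => ->; rewrite horner0.
  have := @ratfun_div_eq k 1 ('X - a%:P) n d _ d0; rewrite r1 div1r => /(_ _ E).
  rewrite polyXsubC_eq0 => /(_ isT) /(congr1 (fun P => P.[a])).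
  rewrite mul1r hornerM !hornerE subrr mulr0 => /eqP; exact/negP.
case/andP: H => d0 nd.
have := @ratfun_div_eq k 'X 1 n d (oner_neq0 _) d0; rewrite r1 divr1 -E invrK.
move=> /(_ erefl) /(congr1 (fun P : {poly k} => size P)).
rewrite mulr1 mulrC size_mulX // => e.
by move: nd; rewrite -e ltnn.
Qed.

Lemma poly_unit_in {k : fieldType} (a : k) (Q : {poly k}) :
  Q.[a] != 0 -> unit_in (stalk (Some a)) (ratfun_of Q).
Proof.
move=> Qa; have r1 := @ratfun_of1 k.
split; first by rewrite ratfun_of_eq0; apply: contraNneq Qa => ->; rewrite horner0.
  by exists Q, 1; rewrite r1 divr1 hornerC oner_eq0.
by exists 1, Q; rewrite r1 div1r.
Qed.

Lemma poly_order_at {k : fieldType} (a : k) (m : nat) (Q : {poly k}) :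
  Q.[a] != 0 ->
  unit_in (stalk (Some a))
    (ratfun_of (Q * ('X - a%:P) ^+ m) / uniformizer (Some a) ^ m%:Z).
Proof.
move=> Qa; have := uniformizer_neq0 (Some a).
rewrite /uniformizer -exprnP ratfun_ofM ratfun_ofX => t0.
by rewrite (mulfK (expf_neq0 _ t0)); apply: poly_unit_in.
Qed.

Lemma poly_order_infty {k : fieldType} (P : {poly k}) :
  P != 0 ->
  unit_in (stalk (None : P1 k))
    (ratfun_of P / uniformizer (None : P1 k) ^ (- (size P).-1%:Z)).
Proof.
move=> P0; set N := (size P).-1.
have -> : uniformizer (None : P1 k) ^ (- N%:Z) = ratfun_of 'X^N.
  by rewrite /uniformizer -invr_expz -exprnP exprVn invrK ratfun_ofX.
have sP : (0 < size P)%N by rewrite size_poly_gt0.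
have sN : size ('X^N : {poly k}) = size P by rewrite size_polyXn prednK.
have XN0 : 'X^N != 0 :> {poly k} by rewrite -size_poly_gt0 sN.
split.
- by rewrite mulf_neq0 // ?invr_eq0 ratfun_of_eq0.
- by exists P, 'X^N; rewrite XN0 sN leqnn.
- exists 'X^N, P; rewrite P0 sN leqnn; split=> //.
  exact: invf_div.
Qed.

Lemma stalk_order {k : fieldType} (p : P1 k) (f : ratfun k) :
  f != 0 -> exists e : int, unit_in (stalk p) (f / uniformizer p ^ e).
Proof.
have [n [d [d0 ->]]] := ratfunP f; move=> nd0.
have n0 : n != 0.
  by apply: contraNneq nd0 => ->; rewrite ratfun_of0 mul0r.
have hA := stalk_subring p; have t0 := uniformizer_neq0 p.
suff order_poly (P : {poly k}) : P != 0 ->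
    exists e : int, unit_in (stalk p) (ratfun_of P / uniformizer p ^ e).
  have [e ue] := order_poly n n0; have [e' ue'] := order_poly d d0.
  by exists (e - e'); apply: order_div.
move=> P0; case: p {hA t0} => [a|]; last first.
  by exists (- (size P).-1%:Z); apply: poly_order_infty.
have [m [Q Qa ->]] := multiplicity_XsubC P a.
by exists m; apply: poly_order_at; move: Qa; rewrite P0.
Qed.

(** The residue field at a point of the affine line is k. *)
Lemma stalk_residue {k : fieldType} (a : k) (f : ratfun k) :
  stalk (Some a) f ->
  exists (b : k) (g : ratfun k), stalk (Some a) g /\
    f = ratfun_of b%:P + uniformizer (Some a) * g.
Proof.
move=> [n [d [-> da]]].
have d0 : d != 0 by apply: contraNneq da => ->; rewrite horner0.
set b := n.[a] / d.[a].
have : root (n - b *: d) a.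
  by rewrite /root !hornerE /b divfK // subrr.
move=> /factor_theorem [q Eq]; exists b, (ratfun_of q / ratfun_of d).
split; first by exists q, d.
have dr0 : ratfun_of d != 0 by rewrite ratfun_of_eq0.
have -> : n = b%:P * d + q * ('X - a%:P) by rewrite -Eq mul_polyC subrKC.
rewrite /= ratfun_ofD !ratfun_ofM mulrDl mulfK //.
by congr (_ + _); rewrite mulrAC mulrC.
Qed.

(** * Points of the curve *)

Lemma algM {K : fieldType} {L : fieldExtType K} (f g : K) :
  (f * g)%:A = f%:A * g%:A :> L.
Proof. exact: (rmorphM (in_alg L)). Qed.

Lemma algB {K : fieldType} {L : fieldExtType K} (f g : K) :
  (f - g)%:A = f%:A - g%:A :> L.
Proof. exact: (rmorphB (in_alg L)). Qed.

Lemma algD {K : fieldType} {L : fieldExtType K} (f g : K) :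
  (f + g)%:A = f%:A + g%:A :> L.
Proof. exact: (rmorphD (in_alg L)). Qed.

Lemma algV {K : fieldType} {L : fieldExtType K} (f : K) :
  (f^-1)%:A = (f%:A)^-1 :> L.
Proof. exact: (fmorphV (in_alg L)). Qed.

Lemma algX {K : fieldType} {L : fieldExtType K} (f : K) n :
  (f ^+ n)%:A = f%:A ^+ n :> L.
Proof. exact: (rmorphXn (in_alg L)). Qed.

Lemma algXz {K : fieldType} {L : fieldExtType K} (f : K) (n : int) :
  (f ^ n)%:A = f%:A ^ n :> L.
Proof. by case: n => n; rewrite ?NegzE -?exprnN ?algV algX. Qed.

Lemma alg_eq0 {K : fieldType} {L : fieldExtType K} (f : K) :
  (f%:A == 0 :> L) = (f == 0).
Proof. exact: (fmorph_eq0 (in_alg L)). Qed.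

Lemma alg_inj {K : fieldType} {L : fieldExtType K} :
  injective (fun f : K => f%:A : L).
Proof. exact: (fmorph_inj (in_alg L)). Qed.

Lemma const_zmod_morphism {k : fieldType} (L : fieldExtType (ratfun k)) :
  zmod_morphism (const L).
Proof. by move=> a b; rewrite /const polyCB ratfun_ofB algB. Qed.

Lemma const_monoid_morphism {k : fieldType} (L : fieldExtType (ratfun k)) :
  monoid_morphism (const L).
Proof.
split=> [|a b]; first by rewrite /const polyC1 ratfun_of1 scale1r.
by rewrite /const polyCM ratfun_ofM algM.
Qed.

HB.instance Definition _ (k : fieldType) (L : fieldExtType (ratfun k)) :=
  GRing.isZmodMorphism.Build k L (const L) (const_zmod_morphism L).

HB.instance Definition _ (k : fieldType) (L : fieldExtType (ratfun k)) :=
  GRing.isMonoidMorphism.Build k L (const L) (const_monoid_morphism L).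

Lemma point_valuation {k : fieldType} {L : fieldExtType (ratfun k)} (x : set L) :
  is_point x -> valuation_set x.
Proof.
case=> xc xB xV _; split=> //; split=> //.
by rewrite -(rmorph1 (const L)); apply: xc.
Qed.

Lemma unit_in_const {k : fieldType} {L : fieldExtType (ratfun k)} (x : set L) a :
  is_point x -> a != 0 -> unit_in x (const L a).
Proof.
case=> xc _ _ _ a0; split; first by rewrite (fmorph_eq0 (const L)).
  exact: xc.
by rewrite -(fmorphV (const L)); apply: xc.
Qed.

Lemma unit_in_alg {k : fieldType} {L : fieldExtType (ratfun k)} (x : set L) p f :
  lies_over x p -> unit_in (stalk p) f -> unit_in x f%:A.
Proof. by move=> xp [f0 pf pf']; split; rewrite ?alg_eq0 -?algV //; apply/xp. Qed.

(** Without points over p, the conditions over p in the definition of the cover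
    and of its bundle would be empty.  A valuation ring of L that contains the
    stalk, and in which the uniformizer is not invertible, cuts out exactly the
    stalk, as any function outside the stalk yields the inverse of the
    uniformizer. *)
Lemma exists_point {k : fieldType} (L : fieldExtType (ratfun k)) (p : P1 k) :
  exists2 x : set L, is_point x & lies_over x p.
Proof.
pose t := uniformizer p.
have t0 : t != 0 := uniformizer_neq0 p.
pose A : set L := [set g | exists2 f, stalk p f & g = f%:A]%classic.
have sp := stalk_subring p.
have hA : subring_set A.
  split; first by exists 1; rewrite ?scale1r //; case: sp.
  move=> _ _ [f pf ->] [g pg ->]; split.
    by exists (f - g); rewrite ?algB //; apply: subring_setB.
  by exists (f * g); rewrite ?algM //; apply: subring_setM.
have [|||B [vB AB nBt]] := chevalley_extension A (t%:A : L) _ hA.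
- by rewrite alg_eq0.
- by exists t => //; apply: stalk_uniformizer.
- rewrite -algV => -[f pf] /alg_inj tf; apply: (stalk_uniformizerV p).
  by rewrite tf.
exists B.
  split; [| |by case: vB|].
  - by move=> a; apply: AB; exists (ratfun_of a%:P) => //; apply: stalk_const.
  - by case: vB => -[].
  - by move=> BT; apply: nBt; rewrite BT.
move=> f; split=> [Bf|pf]; last by apply: AB; exists f.
apply: contrapT => npf; apply: nBt; rewrite -algV.
have f0 : f != 0 by apply: contra_not_neq npf => ->; apply: subring_set0.
have [e ue] := stalk_order p f f0.
have := order_mem (stalk p) t f e sp (stalk_uniformizer p)
  (stalk_uniformizerV p) t0 ue.
case: e ue => e ue [pe ep]; first by case: npf; apply: ep.
have [a pa ->] := order_neg_inv (stalk p) t f e sp (stalk_uniformizer p) t0 ue.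
by rewrite algM; apply: subring_setM => //; [case: vB|apply: AB; exists a].
Qed.

(** * Local analysis at a ramified point *)

(** With r = 0 the uniformizer itself would be a unit at x. *)
Lemma ramification_pos {k : fieldType} {L : fieldExtType (ratfun k)}
    (x : set L) (p : P1 k) (s : L) (r : nat) :
  is_point x -> lies_over x p -> ramification_index x p s r ->
  (0 < r)%N /\ s != 0.
Proof.
move=> hx xp [ts0 _ xts'].
have r0 : (0 < r)%N.
  rewrite lt0n; apply/eqP => r0; move: xts'; rewrite r0 expr0 divr1 -algV.
  by move/(xp (uniformizer p)^-1).1/(stalk_uniformizerV p).
split=> //; move: ts0; apply: contraNneq => ->.
by rewrite expr0n eqn0Ngt r0 invr0 mulr0.
Qed.

Lemma ramified_order {k : fieldType} {L : fieldExtType (ratfun k)}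
    (x : set L) (p : P1 k) (s y : L) (r c : nat) (f : ratfun k) (e : int) :
  is_point x -> lies_over x p -> local_parameter x s ->
  ramification_index x p s r -> (0 < c)%N ->
  y ^+ c = f%:A -> unit_in (stalk p) (f / uniformizer p ^ e) ->
  exists2 n : int, unit_in x (y / s ^ n) & e * r%:Z = n * c%:Z.
Proof.
move=> hx xp ls xr c0 yf uf; have [r0 s0] := ramification_pos x p s r hx xp xr.
have vx := point_valuation x hx; have hA := vx.1.
have t0 := uniformizer_neq0 p.
pose v := (uniformizer p)%:A / s ^+ r.
apply: (order_root x s y ((f / uniformizer p ^ e)%:A * v ^ e)) => //.
  by apply: unit_inM => //; [apply: (unit_in_alg x p)|apply: unit_inXz].
have te0 : uniformizer p ^ e != 0 by apply: expfz_neq0.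
have vE : (uniformizer p)%:A = s ^+ r * v by rewrite mulrC divfK // expf_neq0.
rewrite yf -{1}(divfK te0 f) algM algXz vE expfzMl mulrC -mulrA [v ^ e * _]mulrC.
by rewrite exprnP exprz_exp [r%:Z * e]mulrC.
Qed.

Lemma etale_order {k : fieldType} {L : fieldExtType (ratfun k)}
    (x : set L) (p : P1 k) (s y : L) (c : nat) (f : ratfun k) (e : int) :
  is_point x -> lies_over x p -> local_parameter x s ->
  ramification_index x p s 1 -> (0 < c)%N ->
  y ^+ c = f%:A -> unit_in (stalk p) (f / uniformizer p ^ e) ->
  exists n : int, e = n * c%:Z.
Proof.
move=> hx xp ls xr c0 yf uf.
have [n _ en] := ramified_order x p s y 1 c f e hx xp ls xr c0 yf uf.
by exists n; rewrite -en mulr1.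
Qed.

(** Congruence modulo sA, the maximal ideal at a point with local parameter s. *)
Definition cong {E : fieldType} (A : set E) (s f g : E) : Prop :=
  exists2 u, A u & f - g = s * u.

Lemma cong_refl {E : fieldType} (A : set E) s f : subring_set A -> cong A s f f.
Proof. by exists 0; rewrite ?subrr ?mulr0 //; apply: subring_set0. Qed.

Lemma cong_sym {E : fieldType} (A : set E) s f g :
  subring_set A -> cong A s f g -> cong A s g f.
Proof.
move=> hA [u Au fg]; exists (- u); first exact: subring_setN.
by rewrite mulrN -fg opprB.
Qed.

Lemma cong_trans {E : fieldType} (A : set E) s f g h :
  subring_set A -> cong A s f g -> cong A s g h -> cong A s f h.
Proof.
move=> hA [u Au fg] [v Av gh]; exists (u + v); first exact: subring_setD.
by rewrite mulrDr -fg -gh; ring.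
Qed.

Lemma congM {E : fieldType} (A : set E) s f g f' g' :
  subring_set A -> A f -> A g' ->
  cong A s f g -> cong A s f' g' -> cong A s (f * f') (g * g').
Proof.
move=> hA Af Ag' [u Au fg] [v Av fg'].
exists (f * v + g' * u).
  by apply: subring_setD => //; apply: subring_setM.
by rewrite mulrDr mulrCA -fg' [s * (g' * u)]mulrCA -fg; ring.
Qed.

Lemma congV {E : fieldType} (A : set E) s f g :
  subring_set A -> unit_in A f -> unit_in A g -> cong A s f g ->
  cong A s f^-1 g^-1.
Proof.
move=> hA [f0 Af Af'] [g0 Ag Ag'] [u Au fg].
exists (- (f^-1 * g^-1 * u)).
  by apply: subring_setN => //; do 2 apply: subring_setM => //.
have -> : f^-1 - g^-1 = - (f^-1 * g^-1 * (f - g)) by field; apply/andP.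
by rewrite fg mulrN; congr (- _); rewrite mulrCA.
Qed.

Lemma congXz {E : fieldType} (A : set E) s f g (n : int) :
  subring_set A -> unit_in A f -> unit_in A g -> cong A s f g ->
  cong A s (f ^ n) (g ^ n).
Proof.
move=> hA uf ug fg.
suff hn (m : nat) : cong A s (f ^+ m) (g ^+ m).
  case: n => n; first exact: hn.
  by rewrite NegzE -!exprnN; apply: congV => //; apply: unit_inX.
elim: m => [|m IH]; first exact: cong_refl.
rewrite !exprS; apply: congM => //; first by case: uf.
by apply: subring_setX => //; case: ug.
Qed.

Lemma const_cong {k : fieldType} {L : fieldExtType (ratfun k)} (x : set L)
    (s : L) (a b : k) :
  is_point x -> local_parameter x s -> cong x s (const L a) (const L b) ->
  a = b.
Proof.
move=> hx ls [u xu E]; apply/eqP; rewrite -subr_eq0; apply: contrapT => ab.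
have [] := (ls (const L (a - b))).2 _.
  by exists u => //; rewrite rmorphB.
by move=> _; apply; apply: unit_in_const => //; apply/negP.
Qed.

Lemma subring_set_prod_XsubC {E : fieldType} (A : set E) (rs : seq E) :
  subring_set A -> (forall r, r \in rs -> A r) ->
  forall i, A (\prod_(r <- rs) ('X - r%:P))`_i.
Proof.
move=> hA; elim: rs => [|r rs IH] Ars i.
  rewrite big_nil coef1; case: eqP => // _; last exact: subring_set0.
  by case: hA.
rewrite big_cons; apply: subring_set_coefM => // j; last first.
  by apply: IH => r' rs'; apply: Ars; rewrite inE rs' orbT.
rewrite coefB coefX coefC; apply: subring_setB => //; case: eqP => _.
- by case: hA.
- exact: subring_set0.
- by apply: Ars; rewrite mem_head.
- exact: subring_set0.
Qed.

(** The residue field at x is k.  Since the Galois group preserves x, all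
    conjugates of u are regular at x, hence so are the coefficients of its
    minimal polynomial M, which lie in the stalk at a.  Reducing them modulo the
    uniformizer t gives a nonzero polynomial P0 over k with P0(u) in tx; as k is
    algebraically closed, one of the linear factors of P0(u) is not a unit. *)
Lemma point_residue {k : closedFieldType} {L : splittingFieldType (ratfun k)}
    (x : set L) (a : k) (s u : L) :
  is_point x -> lies_over x (Some a) -> local_parameter x s ->
  galois 1 {:L} ->
  (forall g, g \in 'Gal({:L} / 1)%g -> forall f, x f -> x (g f)) ->
  x u -> exists b : k, cong x s u (const L b).
Proof.
move=> hx xp ls galL stab xu.
have hA := (point_valuation x hx).1.
set t := uniformizer (Some a).
have /(galois_factors (sub1v _)) /(_ u (memvf u)) [r [/fintype.subsetP rG _ ME]] := galL.
set M := minPoly 1 u in ME.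
have xM i : x M`_i.
  rewrite ME; apply: subring_set_prod_XsubC => // _ /mapP[g gr ->].
  by apply: stab => //; apply: rG.
have MK i : exists f : ratfun k, M`_i = f%:A.
  by have /polyOverP/(_ i)/vlineP[f ->] := minPolyOver 1 u; exists f.
have Mres i : exists bG : k * L, x bG.2 /\ M`_i = const L bG.1 + t%:A * bG.2.
  have [f Mf] := MK i; have pf : stalk (Some a) f by apply/xp; rewrite -Mf.
  have [b [g [pg fE]]] := stalk_residue a f pf.
  exists (b, g%:A); split; first exact/xp.
  by rewrite Mf fE algD algM.
have [bG bGP] := choice Mres.
pose P0 : {poly k} := \poly_(i < size M) (bG i).1.
have xt : x t%:A by apply/xp; apply: stalk_uniformizer.
have nxt : ~ x (t%:A)^-1.
  by rewrite -algV => /(xp t^-1).1/(stalk_uniformizerV (Some a)).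
have t0 : t%:A != 0 :> L by rewrite alg_eq0 uniformizer_neq0.
have sM : (0 < size M)%N by rewrite size_poly_gt0 monic_neq0 ?monic_minPoly.
have P00 : P0 != 0.
  apply/eqP => /(congr1 (fun P : {poly k} => P`_(size M).-1)).
  rewrite coef0 coef_poly prednK // leqnn => b0.
  have [xG] := bGP (size M).-1; rewrite b0 rmorph0 add0r.
  have := monicP (monic_minPoly 1 u); rewrite lead_coefE => -> tG.
  apply: nxt; suff -> : (t%:A : L)^-1 = (bG (size M).-1).2 by [].
  by apply: (mulfI t0); rewrite divff.
pose G : L := \sum_(i < size M) (bG i).2 * u ^+ i.
have xG : x G.
  apply: subring_set_sum => // i _; have [xGi _] := bGP i.
  by apply: subring_setM => //; apply: subring_setX.
have PG : (map_poly (const L) P0).[u] = - (t%:A * G).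
  have := minPolyxx 1 u; rewrite -/M horner_coef => M0.
  rewrite (@horner_coef_wide _ (size M)); last first.
    by rewrite size_map_poly size_poly.
  rewrite -[RHS]add0r -[in RHS]M0 /G mulr_sumr -sumrB; apply: eq_bigr => i _.
  rewrite coef_map coef_poly ltn_ord (bGP i).2 mulrA.
  by rewrite mulrDl addrK.
have [rs P0E] := closed_field_poly_normal P0.
apply: contrapT => nb.
have uP : unit_in x (map_poly (const L) P0).[u].
  rewrite P0E map_polyZ hornerZ; apply: unit_inM => //.
    by apply: unit_in_const => //; rewrite lead_coef_eq0.
  rewrite rmorph_prod horner_prod.
  elim: rs {P0E} => [|b rs IH]; first by rewrite big_nil; apply: unit_in1.
  rewrite big_cons; apply: unit_inM => //.
  rewrite /= map_polyXsubC hornerXsubC; apply: contrapT => nu.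
  apply: nb; exists b; have [h _] := ls (u - const L b).
  have [|v xv E] := h _; last by exists v.
  by split=> //; apply: subring_setB => //; case: hx.
move: uP; rewrite PG => -[tG0 _ xtG].
apply: nxt; have -> : (t%:A)^-1 = - (G * (- (t%:A * G))^-1).
  move: tG0; rewrite oppr_eq0 mulf_eq0 negb_or => /andP[_ G0].
  by rewrite invrN mulrN opprK invfM mulrCA divff ?mulr1.
by apply: subring_setN => //; apply: subring_setM.
Qed.

Lemma prim_root_exprz {F : fieldType} (n : nat) (z : F) (i : int) (j : nat) :
  (0 < n)%N -> n.-primitive_root z -> z ^ i = z ^+ j ->
  exists l : int, i = j%:Z + l * n%:Z.
Proof.
move=> n0 pz zi; have nz0 : n%:Z != 0 by rewrite -lt0n in n0 *.
have z0 : z != 0 by apply: contraTneq n0 => z0; have := prim_expr_order pz;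
  rewrite z0 expr0n; case: (n) => // n' /eqP; rewrite eq_sym oner_eq0.
have [N NE] : exists N : nat, (i %% n%:Z)%Z = N.
  by have := modz_ge0 i nz0; case: (i %% n%:Z)%Z => // N _; exists N.
have iE : i = (i %/ n%:Z)%Z * n%:Z + N by rewrite -NE -divz_eq.
have zN : z ^+ N = z ^+ j.
  rewrite -zi {1}iE expfzDr // -exprz_exp exprzAC -!exprnP.
  by rewrite (prim_expr_order pz) exp1rz mul1r.
move/eqP: zN; rewrite (eq_prim_root_expr pz) => /eqP Nj.
exists ((i %/ n%:Z)%Z + (N %/ n)%:Z - (j %/ n)%:Z).
have := divn_eq N n; have := divn_eq j n; rewrite -Nj.
rewrite {1}iE; move: (i %/ n%:Z)%Z (N %/ n)%N (j %/ n)%N (N %% n)%N; lia.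
Qed.

Lemma Zp1_gen (c : nat) (h : 'Z_c) : h \in <[(1%R : 'Z_c)]>%g.
Proof.
have : h \in [set: 'Z_c]%SET by rewrite finset.in_setT.
by rewrite Zp_cycle.
Qed.

(** Let n be the order of y in s.  Applying the generator to y = s^n v, where v
    is a unit with nonzero residue, gives zeta_r^n = zeta_c in the residue field
    k.  Hence c divides r, say r = c r', and zeta_c = zeta_r^r' yields n = r'
    modulo r.  On the other hand c n = r e, so that n = e r' and e = 1 modulo c. *)
Lemma canonical_order {k : closedFieldType} (zeta : nat -> k)
    {L : splittingFieldType (ratfun k)} (c : nat)
    (rho : {morphism [set: 'Z_c] >-> gal_of {:L}})
    (x : set L) (a : k) (y : L) (f : ratfun k) (e : int) :
  compatible_roots zeta -> (0 < c)%N -> galois 1 {:L} ->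
  isom [set: 'Z_c]%G 'Gal({:L} / 1)%g rho ->
  is_point x -> lies_over x (Some a) ->
  canonical_generator zeta rho x (Some a) 1 ->
  rho 1 y = const L (zeta c) * y ->
  y ^+ c = f%:A -> unit_in (stalk (Some a)) (f / uniformizer (Some a) ^ e) ->
  exists l : int, e = 1 + l * c%:Z.
Proof.
move=> [zprim zcomp] c0 galL /isomP[_ imrho] hx xp.
move=> [stab [s [r [ls xr [u xu su]]]]] yz yf uf.
have hA := (point_valuation x hx).1.
have [r0 s0] := ramification_pos x _ s r hx xp xr.
have [n uv en] := ramified_order x _ s y r c f e hx xp ls xr c0 yf uf.
have stabG g : g \in 'Gal({:L} / 1)%g -> forall f, x f -> x (g f).
  rewrite -imrho => /morphimP[h _ _ ->] f' xf'.
  exact: ((stab h).2 (Zp1_gen c h) f').2 xf'.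
have rhoG : rho 1 \in 'Gal({:L} / 1)%g.
  by rewrite -imrho; apply: mem_morphim; rewrite inE.
have sigK f' : rho 1 (f'%:A : L) = f'%:A.
  apply: (fixed_gal (sub1v _) rhoG); exact: memvZ (mem1v _).
set v := y / s ^ n in uv.
have yE : y = s ^ n * v by rewrite mulrC divfK // expfz_neq0.
clearbody v.
have [b vb] := point_residue x a s v hx xp ls galL stabG (let: And3 _ h _ := uv in h).
(* The action on the local parameter: g^* s = s w, with w = zeta_r modulo s. *)
pose w := const L (zeta r) + s * u.
have sw : rho 1 s = s * w.
  by rewrite -[LHS](subrK (const L (zeta r) * s)) su /w; ring.
have ne_unit g : ~ unit_at x (s * g) \/ ~ x g.
  have [xg|] := pselect (x g); last by right.
  by left; case: ((ls (s * g)).2 (ex_intro2 _ _ g xg erefl)).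
have cong_unit g d : x g -> d != 0 -> cong x s g (const L d) -> unit_in x g.
  move=> xg d0 gd; apply: contrapT => ng.
  have [g' xg' gE] := (ls g).1 (conj xg ng).
  have /const_cong dE : cong x s (const L d) (const L 0).
    apply: (cong_trans x s _ g) => //; first exact: cong_sym.
    by exists g' => //; rewrite rmorph0 subr0.
  by move: d0; rewrite (dE hx ls) eqxx.
have b0 : b != 0.
  apply/eqP => b0; move: vb; rewrite b0 rmorph0 => -[g xg]; rewrite subr0 => vE.
  by case: (ne_unit g) => // -[]; rewrite -vE.
have zr0 : zeta r != 0.
  apply/eqP => z0; have := prim_expr_order (zprim r r0).
  by rewrite z0 expr0n eqn0Ngt r0 => /eqP; rewrite eq_sym oner_eq0.
have xs : x s.
  by case: ((ls s).2 _) => //; exists 1; rewrite ?mulr1 //; case: hA.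
have xc : forall d, x (const L d) by case: hx.
have wz : cong x s w (const L (zeta r)) by exists u => //; rewrite /w addrC addKr.
have uw : unit_in x w.
  apply: (cong_unit w (zeta r)) => //.
  by apply: subring_setD => //; apply: subring_setM.
have sigv : w ^ n * rho 1 v = const L (zeta c) * v.
  have sn0 : s ^ n != 0 by apply: expfz_neq0.
  apply: (mulfI sn0); rewrite mulrA -expfzMl -sw mulrCA -yE -yz yE rmorphM.
  by rewrite fmorphXz.
have sigvb : cong x s (rho 1 v) (const L b).
  case: vb => g xg vE; exists (w * rho 1 g).
    by apply: subring_setM => //; [case: uw|apply: stabG].
  by rewrite mulrA -sw -rmorphM -vE rmorphB /= /const sigK.
have zE : zeta r ^ n * b = zeta c * b.
  apply: (const_cong x s) => //; rewrite !rmorphM fmorphXz /=.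
  have uz : unit_in x (const L (zeta r)) by apply: unit_in_const.
  apply: (cong_trans x s _ (w ^ n * rho 1 v)) => //.
    apply: cong_sym => //; apply: congM => //; last exact: congXz.
    by have [] := unit_inXz x w n hA uw.
  rewrite sigv; apply: congM => //; exact: cong_refl.
have {}zE : zeta r ^ n = zeta c by apply: (mulIf b0).
have cr : (c %| r)%N.
  rewrite (prim_order_dvd (zprim c c0)) -zE exprnP exprz_exp mulrC -exprz_exp.
  by rewrite -exprnP (prim_expr_order (zprim r r0)) exp1rz.
case/dvdnP: cr => r' rE; rewrite mulnC in rE.
have r'0 : (0 < r')%N by move: r0; rewrite rE muln_gt0 => /andP[].
have zr' : zeta r ^ n = zeta r ^+ r' by rewrite zE rE zcomp.
have [l nE] := prim_root_exprz r (zeta r) n r' r0 (zprim r r0) zr'.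
have ner : e * r'%:Z = n.
  have cz0 : c%:Z != 0 by rewrite -lt0n in c0 *.
  apply: (mulIf cz0); rewrite -en rE PoszM; ring.
exists l; have r'z0 : r'%:Z != 0 by rewrite -lt0n in r'0 *.
by apply: (mulIf r'z0); rewrite ner nE rE PoszM; ring.
Qed.

(** * The Kummer generator *)

Lemma gal_eigenX {k : closedFieldType} {L : splittingFieldType (ratfun k)}
    (g : gal_of {:L}) (b : k) (psi : L) (n : nat) :
  g \in 'Gal({:L} / 1)%g -> g psi = const L b * psi ->
  (g ^+ n)%g psi = const L (b ^+ n) * psi.
Proof.
move=> gG gpsi; elim: n => [|n IH].
  by rewrite expg0 gal_id expr0 (rmorph1 (const L)) mul1r.
have gb : g (const L (b ^+ n)) = const L (b ^+ n).
  by apply: (fixed_gal (sub1v _) gG); exact: memvZ (mem1v _).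
rewrite expgSr galM ?memvf // IH rmorphM /= gb gpsi.
by rewrite exprS (rmorphM (const L)) /= mulrA [const L b * _]mulrC.
Qed.

Lemma Zp_expg1 (c : nat) (h : 'Z_c) : ((1%R : 'Z_c) ^+ h)%g = h.
Proof. by rewrite Zp_expg mul1n valZpK. Qed.

Lemma eigen_all {k : closedFieldType} {L : splittingFieldType (ratfun k)} (c : nat)
    (rho : {morphism [set: 'Z_c] >-> gal_of {:L}}) (b : k) (psi : L) (h : 'Z_c) :
  isom [set: 'Z_c]%G 'Gal({:L} / 1)%g rho ->
  rho 1 psi = const L b * psi -> rho h psi = const L (b ^+ h) * psi.
Proof.
move=> /isomP[_ imrho] E; rewrite -[in rho h](Zp_expg1 c h).
rewrite morphX ?inE //; apply: gal_eigenX => //.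
by rewrite -imrho; apply: mem_morphim; rewrite inE.
Qed.

(** The Galois group is generated by the image of 1, so its invariants are those
    of rho 1. *)
Lemma fixed_base {k : closedFieldType} {L : splittingFieldType (ratfun k)} (c : nat)
    (rho : {morphism [set: 'Z_c] >-> gal_of {:L}}) (g : L) :
  galois 1 {:L} -> isom [set: 'Z_c]%G 'Gal({:L} / 1)%g rho ->
  rho 1 g = g -> exists f : ratfun k, g = f%:A.
Proof.
move=> /galois_fixedField fixK isorho E; apply/vlineP; rewrite -/(1%VS) -fixK.
apply/fixedFieldP; first exact: memvf.
move=> s; have /isomP[_ <-] := isorho => /morphimP[h _ _ ->].
rewrite (eigen_all c rho 1 g h isorho).
  by rewrite expr1n rmorph1 mul1r.
by rewrite rmorph1 mul1r.
Qed.

(** Hilbert's theorem 90 for the constant z^-1, whose norm is z^-c = 1. *)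
Lemma exists_eigenvector {k : closedFieldType} {L : splittingFieldType (ratfun k)}
    (c : nat) (rho : {morphism [set: 'Z_c] >-> gal_of {:L}}) (z : k) :
  (1 < c)%N -> isom [set: 'Z_c]%G 'Gal({:L} / 1)%g rho -> z ^+ c = 1 ->
  exists2 y : L, y != 0 & rho 1 y = const L z * y.
Proof.
move=> c1 isorho zc; have /isomP[injrho imrho] := isorho.
have z0 : z != 0.
  by apply: contra_eq_neq zc => ->; rewrite expr0n; case: (c) c1 => // c' _;
     rewrite eq_sym oner_neq0.
have cardG : #|'Gal({:L} / 1)%g| = c.
  by rewrite -imrho card_injm // cardsT card_ord Zp_cast.
have genG : generator 'Gal({:L} / 1)%g (rho 1).
  rewrite /generator -imrho -morphim_cycle ?inE //; apply/eqP; congr (_ @* _)%g.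
  by apply/setP => h; rewrite !inE Zp1_gen.
have aL : const L z^-1 \in ({:L})%VS by apply: memvf.
have nrm : galNorm 1 {:L} (const L z^-1) == 1.
  rewrite /galNorm (eq_bigr (fun=> const L z^-1)); last first.
    by move=> g gG; apply: (fixed_gal (sub1v _) gG); exact: memvZ (mem1v _).
  by rewrite prodr_const cardG -rmorphXn exprVn zc invr1 rmorph1.
have [y [_ y0] yE] := elimT (Hilbert's_theorem_90 genG aL) nrm.
exists y => //; have ry0 : rho 1 y != 0 by rewrite fmorph_eq0.
have cz0 : const L z != 0 by rewrite fmorph_eq0.
apply: (mulfI (_ : const L z^-1 != 0)); first by rewrite fmorph_eq0 invr_eq0.
by rewrite {1}yE divfK // mulrA -rmorphM /= mulVf // rmorph1 mul1r.
Qed.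

(** A factor (z - a)^c of N can be removed by dividing y by z - a; so it suffices
    to take N of least degree among the polynomials that are c-th powers of
    eigenvectors. *)
Lemma exists_kummer_poly {k : closedFieldType} {L : splittingFieldType (ratfun k)}
    (c : nat) (rho : {morphism [set: 'Z_c] >-> gal_of {:L}}) (z : k) :
  (1 < c)%N -> galois 1 {:L} -> isom [set: 'Z_c]%G 'Gal({:L} / 1)%g rho ->
  z ^+ c = 1 ->
  exists (y : L) (N : {poly k}),
    [/\ y != 0, rho 1 y = const L z * y, y ^+ c = (ratfun_of N)%:A
      & forall a, ~~ (('X - a%:P) ^+ c %| N)].
Proof.
move=> c1 galL isorho zc; have c0 := ltnW c1.
have rhoG : rho 1 \in 'Gal({:L} / 1)%g.
  by have /isomP[_ <-] := isorho; apply: mem_morphim; rewrite inE.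
have sigK (f : ratfun k) : rho 1 (f%:A : L) = f%:A.
  apply: (fixed_gal (sub1v _) rhoG); exact: memvZ (mem1v _).
pose P n := `[< exists (y : L) (N : {poly k}),
  [/\ y != 0, rho 1 y = const L z * y, y ^+ c = (ratfun_of N)%:A & size N = n] >].
have exP : exists n, P n.
  have [y y0 yz] := exists_eigenvector c rho z c1 isorho zc.
  have [f yf] : exists f : ratfun k, y ^+ c = f%:A.
    apply: (fixed_base c rho) => //.
    by rewrite rmorphXn /= yz exprMn -rmorphXn zc rmorph1 mul1r.
  have [n [d [d0 fE]]] := ratfunP f.
  have dr0 : ratfun_of d != 0 by rewrite ratfun_of_eq0.
  exists (size (n * d ^+ c.-1)); apply/asboolP.
  exists (y * (ratfun_of d)%:A), (n * d ^+ c.-1); split=> //.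
  - by rewrite mulf_neq0 // alg_eq0.
  - by rewrite rmorphM /= sigK yz mulrA.
  - rewrite exprMn yf -algX -algM fE ratfun_ofM ratfun_ofX.
    by rewrite -{1}(prednK c0) exprS mulrA (divfK dr0).
case: (ex_minnP exP) => _ /asboolP[y [N [y0 yz yN <-]]] Nmin.
exists y, N; split=> // a; apply/negP => /dvdpP[M NE].
have N0 : N != 0.
  rewrite -ratfun_of_eq0 -(@alg_eq0 _ L) -yN; exact: expf_neq0.
have X0 : 'X - a%:P != 0 by rewrite polyXsubC_eq0.
have t0 : ratfun_of ('X - a%:P) != 0 by rewrite ratfun_of_eq0.
have tL0 : (ratfun_of ('X - a%:P))%:A != 0 :> L by rewrite alg_eq0.
have := Nmin (size M); rewrite leqNgt => /(_ _)/negP; apply.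
  apply/asboolP; exists (y / (ratfun_of ('X - a%:P))%:A), M; split=> //.
  - by rewrite mulf_neq0 // invr_eq0.
  - by rewrite rmorphM fmorphV /= sigK yz mulrA.
  - rewrite expr_div_n yN NE ratfun_ofM ratfun_ofX algM algX.
    by rewrite mulfK // expf_neq0.
have M0 : M != 0 by apply: contraNneq N0 => M0; rewrite NE M0 mul0r.
rewrite NE size_Mmonic ?monic_exp ?monicXsubC // size_exp_XsubC addnS /=.
by rewrite -[ltnLHS]addn0 ltn_add2l.
Qed.

Lemma prod_XsubC_simple_roots {k : closedFieldType} (N : {poly k}) (rs : seq k) :
  uniq rs ->
  (forall a, exists2 Q : {poly k},
     Q.[a] != 0 & N = Q * ('X - a%:P) ^+ (a \in rs)) ->
  exists2 b : k, b != 0 & N = b *: \prod_(a <- rs) ('X - a%:P).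
Proof.
move=> urs HN.
have N0 : N != 0.
  have [Q Q0 ->] := HN 0; rewrite mulf_neq0 ?expf_neq0 ?polyXsubC_eq0 //.
  by apply: contraNneq Q0 => ->; rewrite horner0.
have /dvdpP[Q0 NE] : \prod_(a <- rs) ('X - a%:P) %| N.
  apply: uniq_roots_dvdp; last by rewrite uniq_rootsE.
  apply/allP => a ars; have [Q _ ->] := HN a.
  by rewrite ars expr1 rootM root_XsubC eqxx orbT.
have : size Q0 == 1%N.
  apply: contraT => /closed_rootP[a /factor_theorem[Q1 Q0E]].
  have X0 : 'X - a%:P != 0 by rewrite polyXsubC_eq0.
  have [Q] := HN a; case: (boolP (a \in rs)) => ars.
    rewrite expr1 NE Q0E (big_rem a) //= mulrA mulrAC => Qa /(mulIf X0) QE.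
    by move: Qa; rewrite -QE !hornerE subrr !(mulr0, mul0r) eqxx.
  rewrite expr0 mulr1 NE Q0E => Qa QE.
  by move: Qa; rewrite -QE !hornerE subrr !(mulr0, mul0r) eqxx.
case/size_poly1P => b b0 Q0E; exists b => //.
by rewrite NE Q0E mul_polyC.
Qed.

Lemma small_residue (n d c : nat) (l : int) :
  (n < c)%N -> (d < c)%N -> n%:Z = d%:Z + l * c%:Z -> n = d.
Proof.
move=> nc dc /(congr1 (fun i => (i %% c%:Z)%Z)).
by rewrite addrC modzMDl !modz_nat !modn_small // => -[].
Qed.

(** The polynomial N is a constant multiple of the product of the z - p_i.  The
    conclusion records the two consequences on which the degree of the bundle
    depends: the order at infinity, and the bound on the orders elsewhere. *)
Lemma kummer_normal_form {k : closedFieldType} (zeta : nat -> k)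
    (m c : nat) (p : 'I_m -> k) {L : splittingFieldType (ratfun k)}
    (rho : {morphism [set: 'Z_c] >-> gal_of {:L}}) :
  compatible_roots zeta -> (1 < c)%N -> injective p ->
  is_cyclic_cover zeta p (fun=> 1) rho ->
  exists (y : L) (N : {poly k}),
    [/\ y != 0, rho 1 y = const L (zeta c) * y, y ^+ c = (ratfun_of N)%:A,
        size N = m.+1 & forall a, ~~ (('X - a%:P) ^+ c %| N)].
Proof.
move=> hzeta c1 pinj [galL isorho etale canon]; have c0 := ltnW c1.
have [zprim _] := hzeta.
have [y [N [y0 yz yN Nfree]]] := exists_kummer_poly c rho (zeta c) c1 galL isorho
  (prim_expr_order (zprim c c0)).
pose rs := [seq p i | i <- enum 'I_m].
suff [b b0 NE] : exists2 b : k, b != 0 & N = b *: \prod_(a <- rs) ('X - a%:P).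
  exists y, N; split=> //; rewrite NE size_scale // size_prod_XsubC size_map.
  by rewrite size_enum_ord.
apply: prod_XsubC_simple_roots; first by rewrite map_inj_uniq ?enum_uniq.
move=> a; have N0 : N != 0.
  by rewrite -ratfun_of_eq0 -(@alg_eq0 _ L) -yN expf_neq0.
have [n [Q Qa NE]] := multiplicity_XsubC N a.
move: Qa; rewrite N0 /= => Qa; exists Q => //.
have nc : (n < c)%N.
  rewrite ltnNge; apply/negP => cn; case/negP: (Nfree a).
  by rewrite NE dvdp_mull // dvdp_exp2l.
have Nord : unit_in (stalk (Some a)) (ratfun_of N / uniformizer (Some a) ^ n%:Z).
  by rewrite NE; apply: poly_order_at.
have [x hx xa] := exists_point L (Some a).
rewrite NE; congr (_ * _ ^+ _); case: (boolP (a \in rs)) => ars.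
  case/mapP: ars => i _ ai.
  have := canon i x hx; rewrite -ai => /(_ xa) cg.
  have [l] := canonical_order zeta c rho x a y _ _ hzeta c0 galL isorho hx xa cg
    yz yN Nord.
  exact: (small_residue n 1 c l).
have [|s ls xr] := etale a x _ hx xa.
  by move=> i ai; case/negP: ars; rewrite ai map_f ?mem_enum.
have [l] := etale_order x _ s y c _ _ hx xa ls xr c0 yN Nord.
by rewrite -[_ * _]add0r; apply: (small_residue n 0 c l).
Qed.

(** * The numbers w_j and kappa *)

Lemma w_bounds (m c j : nat) : 0 <= w m c j < 1.
Proof.
rewrite /w; set t : rat := - _.
have /andP[h1 h2] := floor_itv t; rewrite subr_ge0 h1 /=.
by rewrite ltrBlDl addrC -[1]/(1%:~R) -intrD addrC.
Qed.

Lemma w0 (m c : nat) : w m c 0 = 0.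
Proof. by rewrite /w muln0 mul0r oppr0 subrr. Qed.

Lemma w_period (m c : nat) : (0 < c)%N -> w m c c = 0.
Proof.
move=> c0; rewrite /w natrM mulfK ?pnatr_eq0 -?lt0n //.
have -> : - m%:R = (- m%:Z)%:~R :> rat by rewrite intrN.
by rewrite intrKfloor subrr.
Qed.

(** Both sides differ by an integer and lie in [0, 1). *)
Lemma wS (m c j : nat) :
  w m c j.+1 = w m c 1 + w m c j - ((1 <= w m c 1 + w m c j)%R : nat)%:R.
Proof.
have /andP[a0 a1] := w_bounds m c 1; have /andP[b0 b1] := w_bounds m c j.
set t1 : rat := - ((m * 1)%:R / c%:R); set tj : rat := - ((m * j)%:R / c%:R).
have tE : - ((m * j.+1)%:R / c%:R) = t1 + tj :> rat.
  by rewrite /t1 /tj mulnS muln1 natrD mulrDl opprD.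
have w1E : w m c 1 = t1 - (Num.floor t1)%:~R by [].
have wjE : w m c j = tj - (Num.floor tj)%:~R by [].
set d := (1 <= _).
have -> : w m c j.+1 = t1 + tj - (Num.floor (t1 + tj))%:~R by rewrite -tE.
have -> : Num.floor (t1 + tj) = Num.floor t1 + Num.floor tj + (d : nat)%:Z.
  apply: floor_def; rewrite !intrD -/(1%:~R) /=.
  rewrite /d; case: (lerP 1 (w m c 1 + w m c j)) => h /=; apply/andP; split; lra.
rewrite !intrD w1E wjE; case: (d) => /=; lra.
Qed.

(** The sum of w_(j+1) - w_j over a period is 0.  The index j = 0, absent from
    kappa, contributes nothing since w_0 = 0 and w_1 < 1. *)
Lemma kappaE (m c : nat) : (0 < c)%N -> (kappa m c)%:R = c%:R * w m c 1 :> rat.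
Proof.
move=> c0.
have : \sum_(0 <= j < c) (w m c j.+1 - w m c j) = 0.
  by rewrite telescope_sumr // w_period // w0 subrr.
under eq_bigr => j _ do rewrite wS addrAC addrK.
rewrite sumrB big_const_nat subn0 iter_addr addr0 => /eqP.
rewrite subr_eq0 mulr_natl => /eqP ->.
rewrite /kappa -sum1_card natr_sum big_mkcond /= big_mkord.
apply: eq_bigr => j _; rewrite inE.
case: (posnP j) => [->|] /=; last by case: ifP.
by rewrite w0 addr0 leNgt; have /andP[_ ->] := w_bounds m c 1.
Qed.

Lemma degreeE (m c : nat) : (0 < c)%N ->
  (Num.floor (- (m%:R / c%:R) : rat))%:~R = - ((m + kappa m c)%:R / c%:R) :> rat.
Proof.
move=> c0; have cn0 : c%:R != 0 :> rat by rewrite pnatr_eq0 -lt0n.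
rewrite natrD kappaE // mulrDl [c%:R * _]mulrC mulfK // /w muln1; ring.
Qed.

Lemma order_bound (m c : nat) (e : int) : (0 < c)%N ->
  (0 <= - m%:Z + e * c%:Z) =
  (0 <= e + Num.floor (- (m%:R / c%:R) : rat)).
Proof.
move=> c0; have cp : 0 < c%:R :> rat by rewrite ltr0n.
rewrite -[RHS]lerBlDl sub0r floor_ge_int intrN lerN2.
rewrite ler_pdivrMr // addrC subr_ge0 -(ler_int rat) intrM.
by [].
Qed.

(** * Sections of the bundle *)

(** If g has order e, the two functions have orders v + e c and e + s. *)
Lemma stalk_mul_pow {k : fieldType} (p : P1 k) (N g : ratfun k) (c : nat)
    (v s : int) :
  (0 < c)%N -> unit_in (stalk p) (N / uniformizer p ^ v) ->
  (forall e : int, (0 <= v + e * c%:Z) = (0 <= e + s)) ->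
  stalk p (N * g ^+ c) <-> stalk p (g * uniformizer p ^ s).
Proof.
move=> c0 uN hs; have hA := stalk_subring p; have t0 := uniformizer_neq0 p.
have [->|g0] := eqVneq g 0.
  by rewrite mul0r expr0n eqn0Ngt c0 mulr0.
have [e ue] := stalk_order p g g0.
have At := stalk_uniformizer p; have nAt := stalk_uniformizerV p.
move: (uniformizer p) t0 At nAt uN ue => t t0 At nAt uN ue.
have uNg : unit_in (stalk p) (N * g ^+ c / t ^ (v + e * c%:Z)).
  exact: order_mul_pow.
have ug : unit_in (stalk p) (g * t ^ s / t ^ (e + s)).
  exact: order_shift.
have h1 := order_mem (stalk p) t _ _ hA At nAt t0 uNg.
have h2 := order_mem (stalk p) t _ _ hA At nAt t0 ug.
by split=> [/h1.1|/h2.1]; rewrite ?hs => h; [apply: h2.2|apply: h1.2; rewrite hs].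
Qed.

Lemma point_mem_pow {k : fieldType} {L : fieldExtType (ratfun k)} (x : set L)
    (p : P1 k) (psi : L) (f : ratfun k) (c : nat) :
  is_point x -> lies_over x p -> (0 < c)%N -> psi ^+ c = f%:A ->
  x psi <-> stalk p f.
Proof.
move=> hx xp c0 E; have vx := point_valuation x hx.
split=> [xpsi|pf]; first by apply/xp; rewrite -E; apply: subring_setX => //; case: vx.
by apply: (integrally_closed x psi c) => //; rewrite E; apply/xp.
Qed.

(** A quotient of two eigenvectors for the same character is invariant, hence
    rational; this gives the shape y g.  Regularity of y g is tested on its c-th
    power N g^c. *)
Lemma F_X0P {k : closedFieldType} (zeta : nat -> k) (m c : nat)
    {L : splittingFieldType (ratfun k)}
    (rho : {morphism [set: 'Z_c] >-> gal_of {:L}}) (y : L) (N : {poly k})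
    (U : set (P1 k)) (psi : L) :
  (1 < c)%N -> galois 1 {:L} -> isom [set: 'Z_c]%G 'Gal({:L} / 1)%g rho ->
  y != 0 -> rho 1 y = const L (zeta c) * y -> zeta c != 0 ->
  y ^+ c = (ratfun_of N)%:A ->
  size N = m.+1 -> (forall a, ~~ (('X - a%:P) ^+ c %| N)) ->
  F_X0 rho (V zeta c 1) U psi <->
  exists2 g : ratfun k, psi = y * g%:A &
    O_twist (Num.floor (- (m%:R / c%:R) : rat)) U g.
Proof.
move=> c1 galL isorho y0 yz z0 yN sN Nfree; have c0 := ltnW c1.
set s := Num.floor _.
have N0 : N != 0 by rewrite -size_poly_gt0 sN.
have local p x (g : ratfun k) : is_point x -> lies_over x p ->
    x (y * g%:A) <-> stalk p (if p is Some _ then g else g * uniformizer p ^ s).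
  move=> hx xp.
  have E : (y * g%:A) ^+ c = (ratfun_of N * g ^+ c)%:A.
    by rewrite exprMn yN -algX -algM.
  rewrite (point_mem_pow x p _ _ c hx xp c0 E).
  case: p xp => [a|] xp; last first.
    apply: (stalk_mul_pow None _ _ c (- m%:Z)) => //.
      by have := poly_order_infty N N0; rewrite sN.
    by move=> e; apply: order_bound.
  have [n [Q]] := multiplicity_XsubC N a; rewrite N0 /= => Qa NE.
  have nc : (n < c)%N.
    rewrite ltnNge; apply/negP => cn; case/negP: (Nfree a).
    by rewrite NE dvdp_mull // dvdp_exp2l.
  have := stalk_mul_pow (Some a) (ratfun_of N) g c n 0 c0.
  rewrite expr0z mulr1; apply.
    by rewrite NE; apply: poly_order_at.
  by move=> e; rewrite addr0; apply/idP/idP => ?; nia.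
(* Since c > 1, the class 1 has representative 1 and not 0. *)
have V1 : V zeta c 1 (1%R : 'Z_c) = zeta c.
  by rewrite /V mul1n /= modn_small.
have cz0 : const L (zeta c) != 0 by rewrite fmorph_eq0.
split=> [[push eig]|[g -> Og]].
  have [g gE] : exists g : ratfun k, psi / y = g%:A.
    apply: (fixed_base c rho) => //.
    rewrite rmorphM fmorphV /= yz eig V1 invfM mulrACA divff // mul1r.
    by [].
  have psiE : psi = y * g%:A by rewrite -gE mulrC divfK.
  exists g => // p Up; have [x hx xp] := exists_point L p.
  by apply: (local p x g hx xp).1; rewrite -psiE; apply: (push p).
split; first by move=> p x Up hx xp; apply: (local p x g hx xp).2; apply: Og.
move=> h; rewrite /V mul1n; apply: eigen_all => //.
have rhoG : rho 1 \in 'Gal({:L} / 1)%g.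
  by have /isomP[_ <-] := isorho; apply: mem_morphim; rewrite inE.
rewrite rmorphM /= yz mulrA; congr (_ * _).
by apply: (fixed_gal (sub1v _) rhoG); exact: memvZ (mem1v _).
Qed.

(** The isomorphism is division by y. *)
Lemma multiple_of_O_twist_iso {k : closedFieldType} {L : splittingFieldType (ratfun k)}
    (F : set (P1 k) -> set L) (y : L) (s : int) :
  y != 0 ->
  (forall U psi, F U psi <->
     exists2 g : ratfun k, psi = y * g%:A & O_twist s U g) ->
  sheaf_iso F (O_twist s).
Proof.
move=> y0 FP.
pose theta (psi : L) : (ratfun k)^o :=
  xget 0 [set g : ratfun k | psi = y * g%:A]%classic.
have thE (g : ratfun k) : theta (y * g%:A) = g.
  rewrite /theta; case: xgetP => [g' _|/(_ g)]; last by case.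
  by move=> /(mulfI y0)/alg_inj.
exists (fun=> theta); split=> [U _|U _ a f f' Ua|//].
  split.
  - by move=> psi /FP[g -> Og]; rewrite thE.
  - move=> psi psi'; rewrite !inE => /FP[g -> _] /FP[g' -> _].
    by rewrite !thE => ->.
  - by move=> g Og; exists (y * g%:A); rewrite ?thE //; apply/FP; exists g.
move=> /FP[g -> _] /FP[g' -> _].
have -> : a *: (y * g%:A) + y * g'%:A = y * (a * g + g')%:A.
  by rewrite scalerAr algD mulrDr algM mulr_algl.
by rewrite !thE.
Qed.

(** * The degree of a line bundle is an invariant *)

(** In a fraction with denominator of least degree the denominator has no root:
    a root of it where the function is regular would be a root of the numerator
    as well. *)
Lemma regular_affine_poly {k : closedFieldType} (f : ratfun k) :
  (forall a, stalk (Some a) f) -> exists P : {poly k}, f = ratfun_of P.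
Proof.
move=> reg; have [n [d [d0 fE]]] := ratfunP f.
elim: {d}(size d) {-2}d (erefl (size d)) n d0 fE => [|N IH] d sd n d0 fE.
  by move/eqP: sd; rewrite size_poly_eq0 (negbTE d0).
have [sd1|/closed_rootP[a da]] := boolP (size d == 1%N).
  case/size_poly1P: sd1 => b b0 dE; exists (b^-1 *: n).
  have db : ratfun_of d * ratfun_of (b^-1)%:P = 1.
    by rewrite -ratfun_ofM dE -polyCM divff // ratfun_of1.
  have dr0 : ratfun_of d != 0 by rewrite ratfun_of_eq0.
  apply: (mulIf dr0); rewrite fE (divfK dr0) -mul_polyC ratfun_ofM mulrAC.
  by rewrite [ratfun_of (b^-1)%:P * _]mulrC db mul1r.
have [n' [d' [fE' d'a]]] := reg a.
have d'0 : d' != 0 by apply: contraNneq d'a => ->; rewrite horner0.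
have nd : n * d' = n' * d by apply: ratfun_div_eq => //; rewrite -fE.
have /factor_theorem[n1 n1E] : root n a.
  have : root (n * d') a by rewrite nd rootM da orbT.
  by rewrite rootM [root d' a](negbTE d'a) orbF.
case/factor_theorem: da => d1 d1E.
have d10 : d1 != 0 by apply: contraNneq d0 => d10; rewrite d1E d10 mul0r.
have X0 : 'X - a%:P != 0 by rewrite polyXsubC_eq0.
apply: (IH d1 _ n1 d10).
  by move: sd; rewrite d1E size_Mmonic ?monicXsubC // size_XsubC addn2 /= => -[].
rewrite fE n1E d1E !ratfun_ofM -mulf_div divff ?mulr1 //.
by rewrite ratfun_of_eq0.
Qed.

(** The units of k[z] are constants. *)
Lemma affine_unit_infty {k : closedFieldType} (f g : ratfun k) :
  f * g = 1 -> (forall a, stalk (Some a) f) -> (forall a, stalk (Some a) g) ->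
  unit_in (stalk (None : P1 k)) f.
Proof.
move=> fg /regular_affine_poly[P fE] /regular_affine_poly[Q gE].
have PQ : P * Q = 1.
  have : ratfun_of (P * Q) = ratfun_of 1 by rewrite ratfun_ofM -fE -gE fg ratfun_of1.
  by move/eqP; rewrite tofrac_eq => /eqP.
have /size_poly1P[b b0 PE] : size P == 1%N.
  by have := size_mul_eq1 P Q; rewrite PQ size_poly1 eqxx => /esym/andP[].
rewrite fE PE; split; first by rewrite ratfun_of_eq0 polyC_eq0.
  exact: stalk_const.
have -> : (ratfun_of b%:P)^-1 = ratfun_of (b^-1)%:P.
  have h : ratfun_of b%:P != 0 by rewrite ratfun_of_eq0 polyC_eq0.
  by apply: (mulfI h); rewrite (divff h) -ratfun_ofM -polyCM divff // ratfun_of1.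
exact: stalk_const.
Qed.

Definition sub_presheaf {k : fieldType} {M : lmodType (ratfun k)}
    (F : set (P1 k) -> set M) : Prop :=
  (forall U a f f', regular U a -> F U f -> F U f' -> F U (a *: f + f')) /\
  (forall U U', (U `<=` U')%classic -> (F U' `<=` F U)%classic).

Lemma iso_scale {k : fieldType} {M N : lmodType (ratfun k)}
    (F : set (P1 k) -> set M) (U : set (P1 k)) (theta : M -> N) a f :
  sub_presheaf F -> regular U a -> F U f ->
  (forall a f f', regular U a -> F U f -> F U f' ->
     theta (a *: f + f') = a *: theta f + theta f') ->
  F U (a *: f) /\ theta (a *: f) = a *: theta f.
Proof.
move=> [Fc _] Ua Ff lin.
have Um1 : regular U (-1).
  move=> p _; have hp := stalk_subring p.
  by apply: subring_setN => //; case: hp.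
have z : -1 *: f + f = 0 by rewrite scaleN1r addNr.
have F0 : F U 0 by rewrite -z; apply: Fc.
have t0 : theta 0 = 0 by rewrite -z lin // scaleN1r addNr.
split; first by rewrite -[_ *: _]addr0; apply: Fc.
by rewrite -[X in theta X]addr0 lin // t0 addr0.
Qed.

(** Let psi and psi_z be the sections corresponding to 1 on the affine line and
    to z^s around infinity under the first isomorphism.  On the overlap
    psi_z = z^s psi.  The second isomorphism sends psi to a unit h of k[z], which
    is a constant, and therefore psi_z to z^s h, which is a section of O(s')
    around infinity only if s <= s'. *)
Lemma iso_O_twist_le {k : closedFieldType} {M : lmodType (ratfun k)}
    (F : set (P1 k) -> set M) (s s' : int) :
  sub_presheaf F -> sheaf_iso F (O_twist s) -> sheaf_iso F (O_twist s') ->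
  s <= s'.
Proof.
move=> hF [th [bij lin res]] [th' [bij' lin' res']].
pose U0 : set (P1 k) := [set p | p <> None]%classic.
pose U1 : set (P1 k) := [set p | p <> Some 0]%classic.
pose U01 : set (P1 k) := [set p | p <> None /\ p <> Some 0]%classic.
have oU0 : nonempty_open U0.
  apply: (@sub_finite_set _ _ [set None]%classic); last exact: finite_set1.
  by move=> p /contrapT.
have oU1 : nonempty_open U1.
  apply: (@sub_finite_set _ _ [set Some 0]%classic); last exact: finite_set1.
  by move=> p /contrapT.
have oU01 : nonempty_open U01.
  apply: (@sub_finite_set _ _ ([set None] `|` [set Some 0])%classic); last first.
    by rewrite finite_setU; split; exact: finite_set1.
  by move=> p /not_andP[/contrapT|/contrapT]; [left|right].
have s0 : (U01 `<=` U0)%classic by move=> p [].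
have s1 : (U01 `<=` U1)%classic by move=> p [].
have X0 : ratfun_of 'X != 0 :> ratfun k by rewrite ratfun_of_eq0 polyX_eq0.
pose z := ratfun_of 'X ^ s : ratfun k.
have zreg a : a != 0 -> stalk (Some a) z.
  move=> a0; have [] := @unit_inXz _ (stalk (Some a)) (ratfun_of 'X) s => //.
    exact: stalk_subring.
  by apply: poly_unit_in; rewrite hornerX.
have zO : O_twist s U1 z.
  move=> [a|] pU1; first by apply: zreg; apply/eqP => a0; apply: pU1; rewrite a0.
  rewrite /z /= -expfzMl divff // exp1rz; case: (stalk_subring (None : P1 k)) => //.
have oneO (n : int) : O_twist n U0 (1 : ratfun k).
  by move=> [a|//] _; case: (stalk_subring (Some a)).
have regX : regular U01 z.
  move=> [a|] [] // _ a0; apply: zreg; by apply/eqP => a0'; apply: a0; rewrite a0'.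
have reg0 n (g : ratfun k) : O_twist n U0 g -> forall a, stalk (Some a) g.
  by move=> Og a; apply: (Og (Some a)).
have reg0U (g : ratfun k) : (forall a, stalk (Some a) g) -> regular U0 g.
  by move=> h [a|//] _.
have [f0 Inj Sur] := bij U0 oU0; have [f0' Inj' Sur'] := bij' U0 oU0.
have [psi Fpsi psi1] := Sur 1 (oneO s).
have [psi' Fpsi' psi1'] := Sur' 1 (oneO s').
pose h := th' U0 psi : ratfun k; pose b := th U0 psi' : ratfun k.
have hreg : forall a, stalk (Some a) h by apply: (reg0 s'); apply: f0'.
have breg : forall a, stalk (Some a) b by apply: (reg0 s); apply: f0.
have hb : h * b = 1.
  have [Fb thb] := iso_scale F U0 (th U0) b psi hF (reg0U b breg) Fpsi (lin U0 oU0).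
  have [_ thb'] := iso_scale F U0 (th' U0) b psi hF (reg0U b breg) Fpsi (lin' U0 oU0).
  have bpsi : b *: psi = psi'.
    apply: Inj; rewrite ?inE //; rewrite thb psi1; exact: mulr1.
  by rewrite -[RHS]psi1' -bpsi thb' mulrC.
have uh := affine_unit_infty h b hb hreg breg.
have [_ _ Sur1] := bij U1 oU1; have [f1' _ _] := bij' U1 oU1.
have [psiz Fpsiz psizE] := Sur1 z zO.
have [_ Inj01 _] := bij U01 oU01.
have Fpsi01 : F U01 psi by apply: (hF.2 _ _ s0).
have Fpsiz01 : F U01 psiz by apply: (hF.2 _ _ s1).
have [Fz thz] := iso_scale F U01 (th U01) z psi hF regX Fpsi01 (lin U01 oU01).
have [_ thz'] := iso_scale F U01 (th' U01) z psi hF regX Fpsi01 (lin' U01 oU01).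
have psizpsi : psiz = z *: psi.
  apply: Inj01; rewrite ?inE //.
  rewrite thz (res U01 U1) // (res U01 U0) // psi1 psizE.
  by rewrite [RHS]mulr1.
have := f1' psiz Fpsiz None.
rewrite -(res' U01 U1) // psizpsi thz' (res' U01 U0) // => /(_ _).
rewrite -/h => mem.
have {mem} : stalk (None : P1 k) (z * h * uniformizer None ^ s').
  by apply: mem.
have t0 := uniformizer_neq0 (None : P1 k).
have hA := stalk_subring (None : P1 k).
have zE : z = uniformizer None ^ (- s).
  by rewrite /z /uniformizer exprz_inv opprK.
have := @order_mem _ _ _ (z * h * uniformizer None ^ s') (- s + s') hA
  (stalk_uniformizer None) (stalk_uniformizerV None) t0.
have -> : z * h * uniformizer None ^ s' / uniformizer None ^ (- s + s') = h.
  by rewrite zE; apply: expfz_shift_cancel.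
by move=> /(_ uh)[H _] /H; rewrite addrC subr_ge0.
Qed.

Lemma F_X0_sub_presheaf {k : closedFieldType} {L : splittingFieldType (ratfun k)}
    (c : nat) (rho : {morphism [set: 'Z_c] >-> gal_of {:L}}) (W : 'Z_c -> k) :
  isom [set: 'Z_c]%G 'Gal({:L} / 1)%g rho ->
  sub_presheaf (F_X0 rho W : set (P1 k) -> set L).
Proof.
move=> isorho; split=> [U a f f' Ua [pf ef] [pf' ef']|U U' UU' f [pf ef]]; last first.
  by split=> // p x Up; apply: pf; apply: UU'.
split=> [p x Up hx xp|h].
  have hA := (point_valuation x hx).1.
  apply: subring_setD => //; last exact: (pf' p).
  rewrite -[f]mul1r scalerAl; apply: subring_setM => //; last exact: (pf p).
  by apply/xp; apply: Ua.
have rhoG : rho h \in 'Gal({:L} / 1)%g.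
  by have /isomP[_ <-] := isorho; apply: mem_morphim; rewrite inE.
by rewrite linearP /= ef ef' mulrDr scalerAr.
Qed.

(** * The degree of the bundle *)

Theorem theorem7p5 (k : closedFieldType) (hk : [pchar k] =i pred0)
    (zeta : nat -> k) (hzeta : compatible_roots zeta)
    (m c : nat) (hm : (1 <= m)%N) (hc : (2 <= c)%N)
    (p : 'I_m -> k) (hp : injective p)
    (L : splittingFieldType (ratfun k))
    (rho : {morphism [set: 'Z_c] >-> gal_of {:L}})
    (hX : is_cyclic_cover zeta p (fun=> 1) rho) :
  exists s1 : int,
    unique (fun s : int => sheaf_iso (F_X0 rho (V zeta c 1)) (O_twist s)) s1
    /\ s1%:~R = - ((m + kappa m c)%:R / c%:R) :> rat.
Proof.
have c0 : (0 < c)%N by apply: ltnW.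
have [galL isorho _ _] := hX.
have [y [N [y0 yz yN sN Nfree]]] := kummer_normal_form zeta m c p rho hzeta hc hp hX.
have z0 : zeta c != 0.
  apply/eqP => z0; have := prim_expr_order (hzeta.1 c c0).
  by rewrite z0 expr0n eqn0Ngt c0 => /eqP; rewrite eq_sym oner_eq0.
have iso : sheaf_iso (F_X0 rho (V zeta c 1))
    (O_twist (Num.floor (- (m%:R / c%:R) : rat))).
  apply: (multiple_of_O_twist_iso _ y) => // U psi.
  exact: (F_X0P zeta m c rho y N U psi hc galL isorho y0 yz z0 yN sN Nfree).
have sub := F_X0_sub_presheaf c rho (V zeta c 1) isorho.
exists (Num.floor (- (m%:R / c%:R) : rat)); split; last exact: degreeE.
split=> // s iso'; apply/eqP; rewrite eq_le.
by rewrite (iso_O_twist_le _ _ _ sub iso iso') (iso_O_twist_le _ _ _ sub iso' iso).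
Qed.
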